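(* The satisfiability problem for the EQCONT fragment of the theory of strings (string terms built only from string variables and string constants; atomic predicates equality $t_1 = t_2$ and containment $t_1 \sqsupseteq t_2$; formulas built from these atoms using Boolean negation and conjunction) is NP-hard.
   Context: Strings are finite words over a finite alphabet $\Sigma$; $\epsilon$ denotes the empty string. An instance of the satisfiability problem consists of a finite alphabet $\Sigma$, a formula of the fragment, and for each string variable a natural-number bound on its length. Formulas are conjunctions of Boolean expressions, where a Boolean expression is $\mathit{true}$, $\mathit{false}$, the negation of a Boolean expression, or an atomic predicate. The instance is satisfiable iff there is an assignment of strings over $\Sigma$ to the variables, each respecting its length bound, under which the formula evaluates to true. Semantics: $t_1 = t_2$ holds iff both sides denote the same string; $t_1 \sqsupseteq t_2$ holds iff the string denoted by $t_2$ occurs as a contiguous substring of the string denoted by $t_1$ at some position (in particular every string contains $\epsilon$, and $\epsilon$ contains no nonempty string). *)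

(* Defs.v *)
From mathcomp Require Import all_boot.
Set Implicit Arguments. Unset Strict Implicit. Unset Printing Implicit Defensive.

(* The alphabet Sigma is {0, ..., k-1} (letters are naturals < k).
   String variables are indexed by naturals.  Terms are ONLY variables
   or constants (no concatenation). *)

Inductive sterm : Type :=
  | SVar of nat
  | SConst of seq nat.

Inductive satom : Type :=
  | AEq of sterm & sterm
  | ACont of sterm & sterm.

Inductive bexp : Type :=
  | BTrue
  | BFalse
  | BNot of bexp
  | BAtom of satom.

(* A formula is a conjunction of Boolean expressions. *)
Definition formula := seq bexp.

(* An instance: alphabet size k, a formula, and a length bound for each
   string variable (variable i has bound nth 0 bounds i). *)
Record instance := Instance {
  inst_k : nat;
  inst_phi : formula;
  inst_bounds : seq nat }.

Definition term_val (sigma : nat -> seq nat) (t : sterm) : seq nat :=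
  match t with SVar i => sigma i | SConst s => s end.

Definition atom_val (sigma : nat -> seq nat) (a : satom) : bool :=
  match a with
  | AEq t1 t2 => term_val sigma t1 == term_val sigma t2
  | ACont t1 t2 => infix (term_val sigma t2) (term_val sigma t1)
  end.

Fixpoint bexp_val (sigma : nat -> seq nat) (e : bexp) : bool :=
  match e with
  | BTrue => true
  | BFalse => false
  | BNot e' => ~~ bexp_val sigma e'
  | BAtom a => atom_val sigma a
  end.

Definition term_wf (k nv : nat) (t : sterm) : bool :=
  match t with SVar i => i < nv | SConst s => all (fun a => a < k) s end.

Definition atom_wf (k nv : nat) (a : satom) : bool :=
  match a with
  | AEq t1 t2 => term_wf k nv t1 && term_wf k nv t2
  | ACont t1 t2 => term_wf k nv t1 && term_wf k nv t2
  end.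

Fixpoint bexp_wf (k nv : nat) (e : bexp) : bool :=
  match e with
  | BTrue | BFalse => true
  | BNot e' => bexp_wf k nv e'
  | BAtom a => atom_wf k nv a
  end.

Definition instance_wf (I : instance) : bool :=
  all (bexp_wf (inst_k I) (size (inst_bounds I))) (inst_phi I).

Definition satisfiable (I : instance) : Prop :=
  exists sigma : nat -> seq nat,
    (forall i, i < size (inst_bounds I) ->
       all (fun a => a < inst_k I) (sigma i) /\
       size (sigma i) <= nth 0 (inst_bounds I) i) /\
    all (bexp_val sigma) (inst_phi I).

(* Naturals are written in binary (little endian, no leading zeros);
   each bit is doubled and the number is terminated by the pair 01.
   An instance is first serialized into a prefix-free list of naturals. *)

Fixpoint bits_aux (fuel n : nat) : seq bool :=
  match fuel with
  | 0 => [::]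
  | fuel'.+1 => if n == 0 then [::] else odd n :: bits_aux fuel' n./2
  end.
Definition bits (n : nat) : seq bool := bits_aux n n.

Definition enc_nat (n : nat) : seq bool :=
  flatten (map (fun b => [:: b; b]) (bits n)) ++ [:: false; true].

Definition ser_term (t : sterm) : seq nat :=
  match t with SVar i => [:: 0; i] | SConst s => [:: 1, size s & s] end.

Definition ser_atom (a : satom) : seq nat :=
  match a with
  | AEq t1 t2 => 0 :: ser_term t1 ++ ser_term t2
  | ACont t1 t2 => 1 :: ser_term t1 ++ ser_term t2
  end.

Fixpoint ser_bexp (e : bexp) : seq nat :=
  match e with
  | BTrue => [:: 0]
  | BFalse => [:: 1]
  | BNot e' => 2 :: ser_bexp e'
  | BAtom a => 3 :: ser_atom a
  end.

Definition ser_instance (I : instance) : seq nat :=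
  [:: inst_k I, size (inst_phi I) & flatten (map ser_bexp (inst_phi I))]
  ++ (size (inst_bounds I) :: inst_bounds I).

Definition enc_instance (I : instance) : seq bool :=
  flatten (map enc_nat (ser_instance I)).

Definition EQCONT_SAT (w : seq bool) : Prop :=
  exists I : instance, [/\ instance_wf I, enc_instance I = w & satisfiable I].

(* Deterministic single-tape Turing machines with a two-way infinite
   tape.  Input bits are written with [tm_in]; the output of a halted
   machine is the longest prefix, starting at the head, of cells
   decoded to bits by [tm_out]. *)
Record TM := MkTM {
  tm_state : finType;
  tm_sym : finType;
  tm_blank : tm_sym;
  tm_in : bool -> tm_sym;
  tm_out : tm_sym -> option bool;
  tm_start : tm_state;
  tm_halt : tm_state -> bool;
  tm_accept : tm_state -> bool;
  (* new state, written symbol, move right (true) / left (false) *)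
  tm_delta : tm_state -> tm_sym -> tm_state * tm_sym * bool }.

(* configuration: state, left part of tape (reversed), head cell,
   right part of tape *)
Definition config (M : TM) : Type :=
  (tm_state M * seq (tm_sym M) * tm_sym M * seq (tm_sym M))%type.

Definition tm_step (M : TM) (c : config M) : config M :=
  let: (q, l, h, r) := c in
  if tm_halt q then c else
  let: (q', g, mvr) := tm_delta q h in
  if mvr then (q', g :: l, head (tm_blank M) r, behead r)
  else (q', behead l, head (tm_blank M) l, g :: r).

Definition tm_init (M : TM) (w : seq bool) : config M :=
  let t := map (tm_in M) w in
  (tm_start M, [::], head (tm_blank M) t, behead t).

Definition tm_run (M : TM) (n : nat) (w : seq bool) : config M :=
  iter n (@tm_step M) (tm_init M w).

Definition cfg_state (M : TM) (c : config M) : tm_state M :=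
  let: (q, _, _, _) := c in q.

Fixpoint decode_prefix (M : TM) (s : seq (tm_sym M)) : seq bool :=
  match s with
  | [::] => [::]
  | g :: s' => if @tm_out M g is Some b then b :: @decode_prefix M s' else [::]
  end.

Definition cfg_output (M : TM) (c : config M) : seq bool :=
  let: (_, _, h, r) := c in @decode_prefix M (h :: r).

Definition halts_within (M : TM) (w : seq bool) (t : nat) : Prop :=
  tm_halt (cfg_state (tm_run M t w)).

Definition poly_time (M : TM) : Prop :=
  exists c : nat, forall w : seq bool,
    halts_within M w (c * (size w) ^ c + c).

Definition computes (M : TM) (f : seq bool -> seq bool) : Prop :=
  forall w t, halts_within M w t -> cfg_output (tm_run M t w) = f w.

Definition poly_time_computable (f : seq bool -> seq bool) : Prop :=
  exists M : TM, poly_time M /\ computes M f.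

Definition accepts (M : TM) (w : seq bool) : Prop :=
  exists t, halts_within M w t /\ tm_accept (cfg_state (tm_run M t w)).

Definition pair_enc (w y : seq bool) : seq bool :=
  flatten (map (fun b => [:: b; b]) w) ++ [:: false; true] ++ y.

Definition in_NP (L : seq bool -> Prop) : Prop :=
  exists (V : TM) (c : nat), poly_time V /\
    forall w, L w <->
      exists y : seq bool, size y <= c * (size w) ^ c + c /\
                           accepts V (pair_enc w y).

Definition poly_reducible (L L' : seq bool -> Prop) : Prop :=
  exists f, poly_time_computable f /\ forall w, L w <-> L' (f w).

Definition NP_hard (L' : seq bool -> Prop) : Prop :=
  forall L, in_NP L -> poly_reducible L L'.

(* Main.v *)
From HB Require Import structures.
Require Import Defs.
From mathcomp Require Import all_boot zify.
From Stdlib Require Import FunctionalExtensionality.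
Set Implicit Arguments. Unset Strict Implicit. Unset Printing Implicit Defensive.

(** Cook-Levin carried out directly on string constraints.  The computation tableau of
the verifier is flattened row by row into one sequence [X 1, X 2, ...] of cells over a
finite alphabet; a cell of the next row is determined by three consecutive cells of the
current one, so for the row width [W] the only constraint is a 4-ary relation between
[X v], [X v.+1], [X v.+2] and [X (v + W + 1)].  Nothing goes wrong where a row wraps into
the next one, because both ends of a row stay blank; nondeterminism is confined to the
first row, where the witness is guessed.

A 4-ary relation on finitely many letters becomes a conjunction of containments: use four
disjoint copies of the alphabet, let a variable of length at most 4 contain one letter from
each copy, and require it to be a substring of the constant listing all allowed words,
separated by a marker.

The reduction is computed by programs over finitely many stacks of bits, which are compiled
to single-tape machines holding one stack per track. *)

(** * Binary encodings *)

(** Terms cannot be concatenated, so no literal can speak of a position inside a string; the copies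
    of the alphabet put the position into the letter instead. Four distinct letters fill a string of
    length at most 4, and the marker confines its occurrence to one block of the constant. The price
    is that a cell has four representatives, one for each role in a window; they are tied together
    by one more 4-ary relation, the diagonal. Negation occurs only in the literal making a variable
    nonempty. Acceptance becomes local by forbidding rejection: the verifier halts on every input
    within a known number of steps, and a halted configuration is repeated in all later rows, so an
    accepting run is one without a rejecting cell. The constants of the formula depend on the
    verifier alone. A fixed set of templates is therefore printed over and over with only the
    variable indices changing, and the reduction needs little more than counters. Lengths are kept
    in unary, where nested loops multiply. *)

Lemma bits_aux_fuel f n : n <= f -> bits_aux f n = bits n.
Proof.
rewrite /bits; move: {2}n (leqnn n) => m; elim: m n f => [|m IH] [|n] [|f] //= nm nf.
congr cons; rewrite !IH //; lia.
Qed.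

Lemma bits_rec n : 0 < n -> bits n = odd n :: bits n./2.
Proof. by case: n => // n _; rewrite {1}/bits [LHS]/= bits_aux_fuel //=; lia. Qed.

Lemma bits_double (b : bool) n : 0 < b + n -> bits (b + n.*2) = b :: bits n.
Proof.
move=> bn; rewrite bits_rec; last by lia.
by rewrite oddD odd_double addbF oddb half_bit_double.
Qed.

Fixpoint incb (s : seq bool) : seq bool :=
  match s with
  | [::] => [:: true]
  | false :: s' => true :: s'
  | true :: s' => false :: incb s'
  end.

Lemma bits_incb n : bits n.+1 = incb (bits n).
Proof.
move: {2}n (leqnn n) => m; elim: m n => [|m IH] n nm; first by rewrite (_ : n = 0) //; lia.
case: (posnP n) => [->//|n0].
case: (boolP (odd n)) => on.
  have -> : n = true + (n./2).*2 by lia.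
  rewrite (_ : (true + _).+1 = false + (n./2).+1.*2) //.
  by rewrite !bits_double // IH //; lia.
have -> : n = false + (n./2).*2 by lia.
rewrite (_ : (false + _).+1 = true + (n./2).*2) //.
by rewrite !bits_double //; lia.
Qed.

Lemma bits_inj : injective bits.
Proof.
suff K : cancel bits (foldr (fun (b : bool) n => b + n.*2) 0) by apply: can_inj K.
move=> n; move: {2}n (leqnn n) => m; elim: m n => [|m IH] n nm.
  by rewrite (_ : n = 0) //; lia.
case: (posnP n) => [->//|n0].
rewrite -[n in bits n]odd_double_half bits_double /=; last by lia.
by rewrite IH; lia.
Qed.

Lemma size_bits n : size (bits n) <= n.
Proof.
elim: n => // n IH; rewrite bits_incb; apply: leq_trans (_ : (size (bits n)).+1 <= _) => //.
by elim: (bits n) => // -[] s IHs /=.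
Qed.

Definition dbl (s : seq bool) : seq bool := flatten [seq [:: b; b] | b <- s].

(** The terminating pair 01 has unequal bits, so it cannot be mistaken for a doubled bit. *)
Lemma dbl_stop_inj s1 s2 r1 r2 :
  dbl s1 ++ [:: false, true & r1] = dbl s2 ++ [:: false, true & r2] ->
  s1 = s2 /\ r1 = r2.
Proof.
elim: s1 s2 => [|b s1 IH] [|b' s2] //=; first by case.
- by case: b'.
- by case: b.
- by case=> -> _ /IH[-> ->].
Qed.

Lemma enc_nat_inj n m r1 r2 : enc_nat n ++ r1 = enc_nat m ++ r2 -> n = m /\ r1 = r2.
Proof. by rewrite /enc_nat -!catA => /dbl_stop_inj[/bits_inj]. Qed.

Definition enc_nats (s : seq nat) : seq bool := flatten (map enc_nat s).

Lemma enc_nats_cat s1 s2 : enc_nats (s1 ++ s2) = enc_nats s1 ++ enc_nats s2.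
Proof. by rewrite /enc_nats map_cat flatten_cat. Qed.

Lemma enc_nats_inj : injective enc_nats.
Proof.
have nz n r : enc_nat n ++ r <> [::] by rewrite /enc_nat; case: flatten.
elim=> [|n s IH] [|m s'] //; rewrite /enc_nats /=.
- by move/esym/nz.
- by move/nz.
- by case/enc_nat_inj => -> /IH->.
Qed.

Lemma cat_size_inj (T : Type) (s1 s2 r1 r2 : seq T) :
  size s1 = size s2 -> s1 ++ r1 = s2 ++ r2 -> s1 = s2 /\ r1 = r2.
Proof.
elim: s1 s2 => [|x s1 IH] [|y s2] //= [/IH IH'] [<- /IH'] [-> ->] //.
Qed.

Lemma ser_term_inj t t' r r' :
  ser_term t ++ r = ser_term t' ++ r' -> t = t' /\ r = r'.
Proof.
case: t t' => [i|s] [j|s'] //=; first by case=> -> ->.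
by case=> sz /(cat_size_inj sz)[-> ->].
Qed.

Lemma ser_atom_inj a a' r r' :
  ser_atom a ++ r = ser_atom a' ++ r' -> a = a' /\ r = r'.
Proof.
by case: a a' => [t1 t2|t1 t2] [u1 u2|u1 u2] //= []; rewrite -!catA
  => /ser_term_inj[-> /ser_term_inj[-> ->]].
Qed.

Lemma ser_bexp_inj e e' r r' :
  ser_bexp e ++ r = ser_bexp e' ++ r' -> e = e' /\ r = r'.
Proof.
elim: e e' => [||e IH|a] [||e'|a'] //=; try by case=> ->.
- by case=> /IH[-> ->].
- by case=> /ser_atom_inj[-> ->].
Qed.

(** [EQCONT_SAT] speaks of some instance with the given code; injectivity makes it the instance that
    the reduction built. *)
Lemma enc_instance_inj : injective enc_instance.
Proof.
case=> k phi bs [k' phi' bs'] /enc_nats_inj.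
rewrite /ser_instance /= => -[-> sz eqs]; suff [-> [_ ->]] :
  phi = phi' /\ size bs :: bs = size bs' :: bs' by [].
elim: phi phi' sz eqs => [|e phi IH] [|e' phi'] //= [/IH IH'].
by rewrite -!catA => /ser_bexp_inj[-> /IH'[-> ->]].
Qed.

(** * Stack programs *)

Definition upd (T : Type) (s : nat -> T) (j : nat) (v : T) : nat -> T :=
  fun i => if i == j then v else s i.

Lemma upd_id (T : Type) (s : nat -> T) j : upd s j (s j) = s.
Proof. by apply: functional_extensionality => i; rewrite /upd; case: eqP => [->|]. Qed.

Section TapeView.
Variables (T : Type) (blank : T).

(* The tape is numbered so that the head is at cell [p]; nothing is said about
   cells left of cell 0. *)
Definition tape_at (l : seq T) (h : T) (r : seq T) (p : nat) (tp : nat -> T) :=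
  [/\ tp p = h, forall j, j < p -> tp (p - j.+1) = nth blank l j
    & forall j, tp (p + j.+1) = nth blank r j].

Lemma tape_right l h r p tp g : tape_at l h r p tp ->
  tape_at (g :: l) (head blank r) (behead r) p.+1 (upd tp p g).
Proof.
case=> _ tl tr; split.
- by rewrite /upd ifN; [have := tr 0; rewrite addn1 nth0|lia].
- case=> [|j] jp /=; rewrite /upd; first by rewrite subn1 eqxx.
  by rewrite subSS ifN ?tl //; lia.
- by move=> j; rewrite nth_behead -tr /upd ifN; [congr tp|]; lia.
Qed.

Lemma tape_left l h r p tp g : 0 < p -> tape_at l h r p tp ->
  tape_at (behead l) (head blank l) (g :: r) p.-1 (upd tp p g).
Proof.
move=> p0 [_ tl tr]; split.
- by rewrite /upd ifN; [have := tl 0 p0; rewrite subn1 nth0|lia].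
- by move=> j jp; rewrite nth_behead -tl /upd; [rewrite ifN; [congr tp|]|]; lia.
- case=> [|j] /=; rewrite /upd; first by rewrite ifT //; lia.
  by rewrite -tr ifN; [congr tp|]; lia.
Qed.
End TapeView.

(** Total by construction: [Loop] runs once for each bit its stack holds on entry, so [run] and
    [ops] are structural recursions. [If] and [Loop] pop the bit they find; [If] only distinguishes
    a nonempty stack from an empty one. *)
Inductive cmd :=
  | Skip
  | Push of nat & bool
  | Seq of cmd & cmd
  | If of nat & cmd & cmd
  | Loop of nat & cmd & cmd.

(** Serves to give commands a choice structure, so that lists of commands can form the finite state
    set of a machine. *)
Fixpoint cmd_tree (c : cmd) : GenTree.tree (nat + bool) :=
  match c with
  | Skip => GenTree.Node 0 [::]
  | Push j b => GenTree.Node 1 [:: GenTree.Leaf (inl j); GenTree.Leaf (inr b)]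
  | Seq a b => GenTree.Node 2 [:: cmd_tree a; cmd_tree b]
  | If j a b => GenTree.Node 3 [:: GenTree.Leaf (inl j); cmd_tree a; cmd_tree b]
  | Loop j a b => GenTree.Node 4 [:: GenTree.Leaf (inl j); cmd_tree a; cmd_tree b]
  end.

Fixpoint tree_cmd (t : GenTree.tree (nat + bool)) : option cmd :=
  match t with
  | GenTree.Node 0 [::] => Some Skip
  | GenTree.Node 1 [:: GenTree.Leaf (inl j); GenTree.Leaf (inr b)] => Some (Push j b)
  | GenTree.Node 2 [:: a; b] =>
      if (tree_cmd a, tree_cmd b) is (Some a', Some b') then Some (Seq a' b') else None
  | GenTree.Node 3 [:: GenTree.Leaf (inl j); a; b] =>
      if (tree_cmd a, tree_cmd b) is (Some a', Some b') then Some (If j a' b') else None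
  | GenTree.Node 4 [:: GenTree.Leaf (inl j); a; b] =>
      if (tree_cmd a, tree_cmd b) is (Some a', Some b') then Some (Loop j a' b') else None
  | _ => None
  end.

Lemma cmd_treeK : pcancel cmd_tree tree_cmd.
Proof. by elim=> //= [a -> b ->|j a -> b ->|j a -> b ->]. Qed.

HB.instance Definition _ := Choice.copy cmd (pcan_type cmd_treeK).

Definition store := nat -> seq bool.

Section LoopSemantics.
Variables (f t : store -> store) (cf ct : store -> nat) (j : nat).

Fixpoint loop (l : seq bool) (s : store) : store :=
  if l is b :: l' then loop l' ((if b then t else f) (upd s j l')) else s.

Fixpoint loop_ops (l : seq bool) (s : store) : nat :=
  if l is b :: l' then
    ((if b then ct else cf) (upd s j l')).+1
      + loop_ops l' ((if b then t else f) (upd s j l'))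
  else 1.

Lemma loop_inv (I : seq bool -> store -> Prop) l s :
  (forall b l s, I (b :: l) s -> I l ((if b then t else f) (upd s j l))) ->
  I l s -> I [::] (loop l s).
Proof. by move=> step; elim: l s => //= b l IH s /step /IH. Qed.

Lemma loop_ops_inv (I : seq bool -> store -> Prop) B l s :
  (forall b l s, I (b :: l) s -> I l ((if b then t else f) (upd s j l)) /\
     (if b then ct else cf) (upd s j l) <= B) ->
  I l s -> loop_ops l s <= size l * B.+1 + 1.
Proof.
move=> step; elim: l s => //= b l IH s /step[/IH l1 l2].
by rewrite mulSn -addnA leq_add.
Qed.
End LoopSemantics.

Fixpoint run (c : cmd) (s : store) : store :=
  match c with
  | Skip => s
  | Push j b => upd s j (b :: s j)
  | Seq a b => run b (run a s)
  | If j a e => if s j is _ :: l then run a (upd s j l) else run e s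
  | Loop j f t => loop (run f) (run t) j (s j) s
  end.

Fixpoint ops (c : cmd) (s : store) : nat :=
  match c with
  | Skip | Push _ _ => 1
  | Seq a b => (ops a s + ops b (run a s)).+1
  | If j a e => (if s j is _ :: l then ops a (upd s j l) else ops e s).+1
  | Loop j f t => loop_ops (run f) (run t) (ops f) (ops t) j (s j) s
  end.

Fixpoint mods (j : nat) (c : cmd) : bool :=
  match c with
  | Skip => false
  | Push i _ => i == j
  | Seq a b => mods j a || mods j b
  | If i a b | Loop i a b => [|| i == j, mods j a | mods j b]
  end.

(* Stack indices are below [K], and no loop body touches the stack its loop consumes:
   this is what makes [run] agree with a while loop. *)
Fixpoint cmd_wf (K : nat) (c : cmd) : bool :=
  match c with
  | Skip => true
  | Push j _ => j < K
  | Seq a b => cmd_wf K a && cmd_wf K b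
  | If j a b => [&& j < K, cmd_wf K a & cmd_wf K b]
  | Loop j a b => [&& j < K, cmd_wf K a, cmd_wf K b, ~~ mods j a & ~~ mods j b]
  end.

Lemma run_frame c s j : ~~ mods j c -> run c s j = s j.
Proof.
elim: c s => //= [i b|a IHa b IHb|i a IHa b IHb|i a IHa b IHb] s.
- by rewrite /upd eq_sym => /negbTE->.
- by rewrite negb_or => /andP[ma mb]; rewrite IHb // IHa.
- rewrite !negb_or => /and3P[ij ma mb]; case: (s i) => [|x l]; first by rewrite IHb.
  by rewrite IHa // /upd eq_sym (negbTE ij).
- rewrite !negb_or => /and3P[ij ma mb].
  have ji : (j == i) = false by rewrite eq_sym (negbTE ij).
  move: (s i) => l; elim: l s => //= -[] l IH s';
    by rewrite IH ?IHa ?IHb // /upd ji.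
Qed.

Lemma size_run c s m : (forall j, size (s j) <= m) ->
  forall j, size (run c s j) <= m + ops c s.
Proof.
elim: c s m => //= [|i b|a IHa b IHb|i a IHa b IHb|i a IHa b IHb] s m sm j.
- by rewrite (leq_trans (sm j)) ?leq_addr.
- by rewrite /upd; case: eqP => [<-|_] /=; have := sm j; lia.
- by have := IHb _ _ (IHa _ _ sm) j; lia.
- case E: (s i) => [|x l]; first by have := IHb _ _ sm j; lia.
  have /IHa/(_ j) : forall k, size (upd s i l k) <= m; last by lia.
  by move=> k; rewrite /upd; case: eqP => // _; have := sm i; rewrite E /=; lia.
- have := sm i; move: (s i) => l; elim: l s m sm => [|x l IH] /= s m sm sl.
    by have := sm j; lia.
  have su k : size (upd s i l k) <= m by rewrite /upd; case: eqP => // _; lia.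
  case: x.
    by have := IH _ _ (IHb _ _ su); lia.
  by have := IH _ _ (IHa _ _ su); lia.
Qed.

(* Number of Turing machine steps: each stack operation walks to the top of the
   stack and back. *)
Section LoopTime.
Variables (f t : store -> store) (cf ct : store -> nat) (j : nat).
Fixpoint loop_time (l : seq bool) (s : store) : nat :=
  if l is b :: l' then
    (2 * (size l).+1 + (if b then ct else cf) (upd s j l'))
      + loop_time l' ((if b then t else f) (upd s j l'))
  else 2.
End LoopTime.

Fixpoint time (c : cmd) (s : store) : nat :=
  match c with
  | Skip => 2
  | Push j _ => 2 * (size (s j)).+1
  | Seq a b => 2 + time a s + time b (run a s)
  | If j a e => 2 * (size (s j)).+1
      + if s j is _ :: l then time a (upd s j l) else time e s
  | Loop j f t => loop_time (run f) (run t) (time f) (time t) j (s j) s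
  end.

(** An operation pushes at most one bit, so no stack outgrows [M] during the run, and a walk to the
    top of a stack and back costs at most [2 * M.+1] moves. *)
Lemma time_ops c s m M : (forall j, size (s j) <= m) -> m + ops c s <= M ->
  time c s <= ops c s * (2 * M.+1).
Proof.
elim: c s m => //= [|i b|a IHa b IHb|i a IHa b IHb|i a IHa b IHb] s m sm hM.
- by lia.
- by have := sm i; lia.
- have := IHa _ _ sm; have := IHb _ _ (size_run a sm); nia.
- case E: (s i) hM => [|x l] hM; first by have := IHb _ _ sm; rewrite /=; nia.
  have si := sm i; rewrite E /= in si.
  have su k : size (upd s i l k) <= m by rewrite /upd; case: eqP => // _; lia.
  by have := IHa _ _ su; rewrite /=; nia.
- have := sm i; move: hM; move: (s i) => l; elim: l s m sm => [|x l IH] /= s m sm hM sl; first by lia.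
  have su k : size (upd s i l k) <= m by rewrite /upd; case: eqP => // _; lia.
  case: x hM => /= hM.
    have h1 := IHb _ _ su ltac:(lia).
    by have := IH _ _ (size_run b su) ltac:(lia) ltac:(lia); nia.
  have h1 := IHa _ _ su ltac:(lia).
    by have := IH _ _ (size_run a su) ltac:(lia) ltac:(lia); nia.
Qed.

(** * Compilation to Turing machines *)

(** Continuations, that is stacks of pending commands, met while executing [c] before [k]; a loop
    stays pending below its own body, which keeps the list finite. *)
Fixpoint reach (c : cmd) (k : seq cmd) : seq (seq cmd) :=
  (c :: k) ::
  match c with
  | Skip | Push _ _ => [::]
  | Seq a b => reach a (b :: k) ++ reach b k
  | If _ a e => reach a k ++ reach e k
  | Loop _ f t => reach f (c :: k) ++ reach t (c :: k)
  end.

Definition nexts (ks : seq cmd) : seq (seq cmd) :=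
  if ks is c :: k then
    match c with
    | Skip | Push _ _ => [:: k]
    | Seq a b => [:: a :: b :: k]
    | If _ a e => [:: a :: k; e :: k]
    | Loop _ f t => [:: f :: ks; t :: ks; k]
    end
  else [::].

Lemma reach_head c k : c :: k \in reach c k.
Proof. by case: c => *; rewrite /= inE eqxx. Qed.

Lemma reach_nexts (S : seq (seq cmd)) c k :
  k \in S -> {subset reach c k <= S} ->
  {in reach c k, forall ks, {subset nexts ks <= S}}.
Proof.
elim: c k => [|j b|a IHa b IHb|j a IHa b IHb|j a IHa b IHb] k kS sub ks.
- by rewrite inE => /eqP-> x /=; rewrite inE => /eqP->.
- by rewrite inE => /eqP-> x /=; rewrite inE => /eqP->.
- have subA : {subset reach a (b :: k) <= S}.
    by move=> x xa; apply: sub; rewrite /= inE mem_cat xa orbT.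
  have subB : {subset reach b k <= S}.
    by move=> x xa; apply: sub; rewrite /= inE mem_cat xa !orbT.
  rewrite /= inE mem_cat => /or3P[/eqP->|/IHa|/IHb]; last 2 first.
  + by apply=> //; apply: subB; apply: reach_head.
  + exact.
  by move=> x /=; rewrite inE => /eqP->; apply/subA/reach_head.
- have subA : {subset reach a k <= S}.
    by move=> x xa; apply: sub; rewrite /= inE mem_cat xa orbT.
  have subB : {subset reach b k <= S}.
    by move=> x xa; apply: sub; rewrite /= inE mem_cat xa !orbT.
  rewrite /= inE mem_cat => /or3P[/eqP->|/IHa|/IHb]; [|exact|exact].
  by move=> x /=; rewrite !inE => /orP[] /eqP->; [apply/subA|apply/subB]; apply: reach_head.
- have cS : Loop j a b :: k \in S by apply/sub/reach_head.
  have subA : {subset reach a (Loop j a b :: k) <= S}.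
    by move=> x xa; apply: sub; rewrite /= inE mem_cat xa orbT.
  have subB : {subset reach b (Loop j a b :: k) <= S}.
    by move=> x xa; apply: sub; rewrite /= inE mem_cat xa !orbT.
  rewrite /= inE mem_cat => /or3P[/eqP->|/IHa|/IHb]; [|exact|exact].
  move=> x /=; rewrite !inE => /or3P[] /eqP-> //.
    by apply/subA; apply: reach_head.
  by apply/subB; apply: reach_head.
Qed.

(** [Init] and [Mark] put the marker on the cell left of the input; [Seek] walks right to the first
    cell that is empty on the track, [Read] inspects the cell before it, and [Ret] walks back to the
    marker. *)
Inductive phase := Init | Mark | Seek | Read | Ret.

Definition phase_ord (p : phase) : 'I_5 :=
  match p with
  | Init => @Ordinal 5 0 isT | Mark => @Ordinal 5 1 isT | Seek => @Ordinal 5 2 isT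
  | Read => @Ordinal 5 3 isT | Ret => @Ordinal 5 4 isT
  end.
Definition ord_phase (i : 'I_5) : phase := nth Init [:: Init; Mark; Seek; Read; Ret] i.
Lemma phase_ordK : cancel phase_ord ord_phase. Proof. by case. Qed.
HB.instance Definition _ := Finite.copy phase (can_type phase_ordK).

Section Machine.
Variables (K : nat) (prog : cmd).

(* One track per stack, bottom of the stack at cell 1; the flag marks cell 0. *)
Definition sym : Type := (bool * {ffun 'I_K.+1 -> option bool})%type.
Definition sym0 : sym := (false, [ffun=> None]).
Definition track (g : sym) (j : nat) : option bool := g.2 (inord j).
Definition set_track (g : sym) (j : nat) (v : option bool) : sym :=
  (g.1, [ffun i => if i == inord j then v else g.2 i]).

Definition kstep (ks : seq cmd) (ph : phase) (g : sym) : seq cmd * phase * sym * bool :=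
  match ph with
  | Init => (ks, Mark, g, false)
  | Mark => (ks, Seek, (true, [ffun=> None]), true)
  | Ret => if g.1 then (ks, Seek, g, true) else (ks, Ret, g, false)
  | Seek =>
      if ks is c :: k then
        match c with
        | Skip => (k, Ret, g, false)
        | Seq a b => (a :: b :: k, Ret, g, false)
        | Push j b => if track g j is None then (k, Ret, set_track g j (Some b), false)
                      else (ks, Seek, g, true)
        | If j _ _ | Loop j _ _ =>
            if track g j is None then (ks, Read, g, false) else (ks, Seek, g, true)
        end
      else (ks, Seek, g, true)
  | Read =>
      match ks with
      | If j a e :: k => if g.1 then (e :: k, Seek, g, true)
                         else (a :: k, Ret, set_track g j None, false)
      | Loop j f t :: k =>
          if g.1 then (k, Seek, g, true)
          else ((if track g j == Some true then t else f) :: ks, Ret,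
                set_track g j None, false)
      | _ => (ks, Read, g, false)
      end
  end.

Definition konts : seq (seq cmd) := [::] :: reach prog [::].

Lemma kstep_konts ks ph g : ks \in konts -> (kstep ks ph g).1.1.1 \in konts.
Proof.
move=> kR.
have cl : {subset nexts ks <= konts}.
  move: kR; rewrite inE => /predU1P[-> //|].
  by apply: reach_nexts => [|x xr]; rewrite inE ?eqxx // xr orbT.
case: ph => //=; last by case: ifP.
- case: ks kR cl => // -[|j b|a b|j a b|j a b] k kR cl //=.
  + by apply: cl; rewrite inE.
  + by case: track => //=; apply: cl; rewrite inE.
  + by apply: cl; rewrite inE.
  + by case: track.
  + by case: track.
- case: ks kR cl => // -[|j b|a b|j a b|j a b] k kR cl //=.
  + by case: ifP => _ /=; apply: cl; rewrite !inE eqxx ?orbT.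
  + by case: ifP => _ /=; [|case: ifP]; move=> *; apply: cl; rewrite !inE eqxx ?orbT.
Qed.

Definition mstate : finType := (seq_sub konts * phase)%type.

Definition kont0 : seq_sub konts := insubd (SeqSub (mem_head [::] _)) [:: prog].

(** Every stack operation ends at cell 1, so a halted machine outputs stack 1 from the bottom; the
    input likewise has its first bit at the bottom of stack 0. The default of [insubd] in the
    transition function is never reached, by [kstep_konts]. *)
Definition machine : TM := {|
  tm_state := mstate;
  tm_sym := sym;
  tm_blank := sym0;
  tm_in := fun b => (false, [ffun j => if j == inord 0 then Some b else None]);
  tm_out := fun g => track g 1;
  tm_start := (kont0, Init);
  tm_halt := fun q => (val q.1 == [::]) && (q.2 == Seek);
  tm_accept := fun=> true;
  tm_delta := fun q g =>
    let: (ks, ph, g', mv) := kstep (val q.1) q.2 g in ((insubd q.1 ks, ph), g', mv) |}.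

(** The tape as a total function of an absolute position, so that tape contents are compared by
    extensionality. *)
Definition rconfig : Type := (seq cmd * phase * nat * (nat -> sym))%type.

Definition rhalt (a : rconfig) : bool :=
  let: (ks, ph, _, _) := a in (ks == [::]) && (ph == Seek).

Definition rstep (a : rconfig) : rconfig :=
  let: (ks, ph, p, tp) := a in
  if rhalt a then a else
  let: (ks', ph', g, mv) := kstep ks ph (tp p) in
  (ks', ph', if mv then p.+1 else p.-1, upd tp p g).

(** Excludes moves to the left of cell 0, where [p.-1] would be the wrong position and [tape_at]
    gives no information. *)
Definition rgood (a : rconfig) : bool :=
  let: (ks, ph, p, tp) := a in (kstep ks ph (tp p)).2 || (0 < p).

Definition represents (c : config machine) (a : rconfig) : Prop :=
  let: (q, l, h, r) := c in let: (ks, ph, p, tp) := a in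
  [/\ val q.1 = ks, q.2 = ph & tape_at sym0 l h r p tp].

Lemma represents_step c a : rgood a -> represents c a -> represents (tm_step c) (rstep a).
Proof.
case: c => [[[[q qph] l] h] r]; case: a => [[[ks ph] p] tp] /= good [qks qphE tpr]; subst ks ph.
rewrite /tm_step /rstep /rhalt /=; case: ifP => // _.
have [hp _ _] := tpr; rewrite hp in good *.
move: (kstep_konts qph h (valP q)) good; rewrite /=.
case: (kstep (ssval q) qph h) => [[[ks' ph'] g] []] /= inR p0; split=> //=; rewrite ?insubdK //.
  exact: tape_right tpr.
exact: tape_left tpr.
Qed.

Fixpoint steps (n : nat) (a b : rconfig) : Prop :=
  if n is n'.+1 then rgood a /\ steps n' (rstep a) b else a = b.

Lemma steps_add n m a b c : steps n a b -> steps m b c -> steps (n + m) a c.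
Proof. by elim: n a => [a ->|n IH a [ga /IH s]] //= /s. Qed.

Lemma represents_steps n c a b : represents c a -> steps n a b ->
  represents (iter n (@tm_step machine) c) b.
Proof.
elim: n c a => [c a ca <-//|n IH c a ca [ga sb]].
by rewrite iterSr; apply: IH sb; apply: represents_step.
Qed.

Definition layout (s : store) (i : nat) : sym :=
  (i == 0, [ffun j : 'I_K.+1 => if i is i'.+1 then nth None (map Some (rev (s j))) i' else None]).

Lemma track_layout s i j : j < K.+1 ->
  track (layout s i.+1) j = nth None (map Some (rev (s j))) i.
Proof. by move=> jK; rewrite /track ffunE inordK. Qed.

Lemma track_layout_top s j : j < K.+1 -> track (layout s (size (s j)).+1) j = None.
Proof. by move=> jK; rewrite track_layout // nth_default // size_map size_rev. Qed.

Lemma eq_inord j (k : 'I_K.+1) : j < K.+1 -> (k == inord j) = (k == j :> nat).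
Proof. by move=> jK; rewrite -val_eqE /= inordK. Qed.

Lemma layout_push s j b : j < K.+1 ->
  upd (layout s) (size (s j)).+1 (set_track (layout s (size (s j)).+1) j (Some b))
  = layout (upd s j (b :: s j)).
Proof.
move=> jK; apply: functional_extensionality => i; rewrite /upd.
case: eqP => [->|ne].
  congr pair; apply/ffunP => k; rewrite !ffunE eq_inord //.
  case: eqP => [_|//]; rewrite rev_cons map_rcons nth_rcons size_map size_rev.
  by rewrite ltnn eqxx.
case: i ne => [|i] ne; congr pair; apply/ffunP => k; rewrite !ffunE //.
case: eqP => [->|//]; rewrite rev_cons map_rcons nth_rcons size_map size_rev.
by case: ltngtP => [//|lt|E]; [rewrite nth_default ?size_map ?size_rev // ltnW|case: ne; rewrite E].
Qed.

Lemma layout_pop s j b l : j < K.+1 -> s j = b :: l ->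
  upd (layout s) (size (s j)) (set_track (layout s (size (s j))) j None)
  = layout (upd s j l).
Proof.
move=> jK sj; rewrite sj /=; apply: functional_extensionality => i; rewrite /upd.
case: eqP => [->|ne].
  congr pair; apply/ffunP => k; rewrite !ffunE eq_inord //.
  by case: eqP => [_|//]; rewrite nth_default // size_map size_rev.
case: i ne => [|i] ne; congr pair; apply/ffunP => k; rewrite !ffunE //.
case: eqP => [->|//]; rewrite sj rev_cons map_rcons nth_rcons size_map size_rev.
by case: ltngtP => [//|lt|E]; [rewrite nth_default ?size_map ?size_rev // ltnW|case: ne; rewrite E].
Qed.

Definition seeks (c : cmd) (j : nat) : bool :=
  match c with Push i _ | If i _ _ | Loop i _ _ => i == j | _ => false end.

Lemma seek_steps c k s j p : j < K.+1 -> seeks c j -> p <= size (s j) ->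
  steps (size (s j) - p) (c :: k, Seek, p.+1, layout s)
                         (c :: k, Seek, (size (s j)).+1, layout s).
Proof.
move=> jK cj ps; have [d E] : exists d, d = size (s j) - p by eexists.
rewrite -E; elim: d p ps E => [|d IH] p ps E; first by rewrite /= (_ : p = size (s j)) //; lia.
have [b tb] : exists b, track (layout s p.+1) j = Some b.
  by rewrite track_layout // (nth_map true) ?size_rev; [eexists|lia].
have ks : kstep (c :: k) Seek (layout s p.+1) = (c :: k, Seek, layout s p.+1, true).
  by case: c cj {IH} => //= i; [move=> b'|move=> a a'|move=> a a'] => /eqP->; rewrite tb.
split; first by rewrite /rgood ks.
by rewrite /rstep /= -/(kstep (c :: k) Seek _) ks upd_id; apply: IH; lia.
Qed.

Lemma ret_steps k s p : steps p.+1 (k, Ret, p, layout s) (k, Seek, 1, layout s).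
Proof.
elim: p => [|p IH]; first by rewrite /= andbF upd_id.
have E : rstep (k, Ret, p.+1, layout s) = (k, Ret, p, layout s).
  by rewrite /= andbF upd_id.
by split=> //; rewrite E.
Qed.

Lemma steps1 ks ph p tp ks' ph' g mv :
  ks != [::] -> kstep ks ph (tp p) = (ks', ph', g, mv) -> mv || (0 < p) ->
  steps 1 (ks, ph, p, tp) (ks', ph', if mv then p.+1 else p.-1, upd tp p g).
Proof. by move=> nk E m; rewrite /= E; split=> //; rewrite (negbTE nk). Qed.

Arguments steps : simpl never.

Lemma pop_empty_steps c k s j ks' : j < K.+1 -> seeks c j ->
  (forall i b, c <> Push i b) -> s j = [::] ->
  kstep (c :: k) Read (layout s 0) = (ks', Seek, layout s 0, true) ->
  steps 2 (c :: k, Seek, 1, layout s) (ks', Seek, 1, layout s).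
Proof.
move=> jK cj np sj E; apply: (@steps_add 1 1 _ (c :: k, Read, 0, layout s)).
  rewrite -{2}[layout s](upd_id _ 1); apply: (steps1 (mv := false)) => //.
  have := track_layout_top s jK; rewrite sj /=.
  by case: c cj np {E} => // i; [move=> b _ /(_ i b)|move=> a b|move=> a b] => // /eqP-> _ ->.
by rewrite -{2}[layout s](upd_id _ 0); apply: (steps1 (mv := true)).
Qed.

Lemma pop_steps c k s j ks' b l : j < K.+1 -> seeks c j ->
  (forall i b, c <> Push i b) -> s j = b :: l ->
  kstep (c :: k) Read (layout s (size (s j))) =
    (ks', Ret, set_track (layout s (size (s j))) j None, false) ->
  steps (2 * (size (s j)).+1) (c :: k, Seek, 1, layout s) (ks', Seek, 1, layout (upd s j l)).
Proof.
move=> jK cj np sj E.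
rewrite (_ : 2 * _ = (size (s j) - 0) + (1 + (1 + (size (s j)).-1.+1))); last by rewrite sj /=; lia.
apply: steps_add (seek_steps k jK cj (leq0n _)) _.
apply: (@steps_add 1 _ _ (c :: k, Read, size (s j), layout s)).
  rewrite -{2}[layout s](upd_id _ (size (s j)).+1); apply: (steps1 (mv := false)) => //.
  have := track_layout_top s jK.
  by case: c cj np {E} => // i; [move=> b' _ /(_ i b')|move=> a a'|move=> a a'] => //= /eqP-> _ ->.
apply: steps_add (steps1 (mv := false) _ E _) _ => //; first by rewrite sj.
by rewrite (layout_pop jK sj); apply: ret_steps.
Qed.

Lemma run_steps c k s : cmd_wf K.+1 c ->
  steps (time c s) (c :: k, Seek, 1, layout s) (k, Seek, 1, layout (run c s)).
Proof.
have bounce c' ks' ks s' : kstep (c' :: ks) Seek (layout s' 1) = (ks', Ret, layout s' 1, false) ->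
    steps 2 (c' :: ks, Seek, 1, layout s') (ks', Seek, 1, layout s').
  move=> E; apply: (@steps_add 1 1 _ (ks', Ret, 0, layout s')); last exact: ret_steps.
  by rewrite -{2}[layout s'](upd_id _ 1); apply: (steps1 (mv := false)).
elim: c k s => [|j b|a IHa b IHb|j a IHa b IHb|j a IHa b IHb] k s.
- by move=> _; apply: bounce.
- move=> jK; rewrite (_ : time _ _ = (size (s j) - 0) + (1 + (size (s j)).+1)); last by rewrite /=; lia.
  apply: (steps_add (@seek_steps (Push j b) k s j 0 jK (eqxx j) (leq0n _))).
  apply: steps_add (steps1 (mv := false) _ _ _) _ => //=.
    by rewrite track_layout_top.
  by rewrite layout_push //; apply: ret_steps.
- case/andP=> wa wb; rewrite [time _ _]/= -addnA; apply: steps_add (bounce _ _ _ _ _) _ => //.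
  by apply: steps_add (IHa _ _ wa) (IHb _ _ wb).
- case/and3P=> jK wa wb /=; case E: (s j) => [|x l].
    apply: steps_add (IHb _ _ wb); apply: (pop_empty_steps jK) => //=.
  apply: steps_add (IHa _ _ wa); rewrite -E; apply: (pop_steps jK) => //=; rewrite E //=.
- case/and5P=> jK wa wb ma mb /=; move: {2 3 4}(s j) (erefl (s j)) => l.
  elim: l s => [|x l IH] s sj /=.
    by apply: (pop_empty_steps jK) => //=.
  apply: steps_add (IH _ _); last first.
    by case: x sj => sj; rewrite run_frame // /upd eqxx.
  apply: steps_add (_ : steps _ _ ((if x then b else a) :: Loop j a b :: k, Seek, 1, layout (upd s j l))) _.
    rewrite -[(size l).+1]/(size (x :: l)) -sj; apply: (pop_steps jK) => //=.
      exact: sj.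
    rewrite sj /= track_layout // sj rev_cons map_rcons nth_rcons size_map size_rev.
    by rewrite ltnn eqxx; case: x sj.
  by case: x sj => _; [apply: IHb|apply: IHa].
Qed.

End Machine.

(** * Polynomial time *)

(** The base [n.+2] is at least 2, so raising the exponent absorbs constants and sums. *)
Definition poly_bounded (g : nat -> nat) : Prop := exists d, forall n, g n <= n.+2 ^ d.

Lemma poly_bounded_le g g' : (forall n, g n <= g' n) -> poly_bounded g' -> poly_bounded g.
Proof. by move=> gg [d h]; exists d => n; apply: leq_trans (gg n) (h n). Qed.

Lemma poly_bounded_const a : poly_bounded (fun=> a).
Proof.
exists a => n; apply: leq_trans (_ : 2 ^ a <= _); first by rewrite ltnW // ltn_expl.
by case: a => // a; rewrite leq_exp2r.
Qed.

Lemma poly_bounded_id : poly_bounded id.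
Proof. by exists 1 => n; rewrite expn1; lia. Qed.

Lemma poly_bounded_mul g h :
  poly_bounded g -> poly_bounded h -> poly_bounded (fun n => g n * h n).
Proof. by move=> [d hd] [e he]; exists (d + e) => n; rewrite expnD leq_mul. Qed.

Lemma poly_bounded_add g h :
  poly_bounded g -> poly_bounded h -> poly_bounded (fun n => g n + h n).
Proof.
move=> [d hd] [e he]; exists (d + e).+1 => n; rewrite expnS.
have := hd n; have := he n.
have h1 : n.+2 ^ d <= n.+2 ^ (d + e) by rewrite leq_exp2l // leq_addr.
have h2 : n.+2 ^ e <= n.+2 ^ (d + e) by rewrite leq_exp2l // leq_addl.
by nia.
Qed.

Lemma poly_bounded_exp g c : poly_bounded g -> poly_bounded (fun n => g n ^ c).
Proof.
by move=> [d hd]; exists (d * c) => n; rewrite expnM; case: c => // c; rewrite leq_exp2r.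
Qed.

Lemma poly_bounded_mono g : poly_bounded g -> exists c, forall n, g n <= c * n ^ c + c.
Proof.
(* For positive [n] the base [n.+2] is at most [3 * n], and [d <= 3 ^ d]; for [n = 0] the additive
   constant covers [2 ^ d]. *)
case=> d hd; exists (3 ^ d) => n; apply: leq_trans (hd n) _.
case: n => [|n].
  apply: leq_trans (leq_addl _ _); by case: d {hd} => // d; rewrite leq_exp2r.
apply: leq_trans (leq_addr _ _).
apply: (@leq_trans ((3 * n.+1) ^ d)).
  by case: d {hd} => // d; rewrite leq_exp2r //; lia.
by rewrite expnMn leq_mul // leq_pexp2l // ltnW // ltn_expl.
Qed.

Definition init_store (w : seq bool) : store := fun j => if j == 0 then rev w else [::].

Lemma halted_iter M (c : config M) t t' : tm_halt (cfg_state (iter t (@tm_step M) c)) ->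
  t <= t' -> iter t' (@tm_step M) c = iter t (@tm_step M) c.
Proof.
move=> h /subnK <-; elim: (t' - t) => // d IH; rewrite addSn iterS IH.
by case: (iter _ _ _) h => [[[q l] s] r] /= ->.
Qed.

Section CmdPoly.
Variables (K : nat) (prog : cmd) (f : seq bool -> seq bool) (g : nat -> nat).
Hypothesis prog_wf : cmd_wf K.+2 prog.
Hypothesis progE : forall w, rev (run prog (init_store w) 1) = f w.
Hypothesis prog_ops : forall w, ops prog (init_store w) <= g (size w).
Hypothesis g_poly : poly_bounded g.

Let M := machine K.+1 prog.

Lemma init_steps w : exists2 a, represents (tm_init M w) a &
  @steps K.+1 (2 + time prog (init_store w)) a
    ([::], Seek, 1, layout K.+1 (run prog (init_store w))).
Proof.
(* Cell 1 carries the first input bit; the moves of [Init] and [Mark] visit the blank cell 0 and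
   come back. *)
pose tp i := if i is i'.+1 then nth (sym0 K.+1) (map (@tm_in M) w) i' else sym0 K.+1.
exists ([:: prog], Init, 1, tp).
  rewrite /represents /tm_init /=; split=> //.
    by rewrite insubdK // inE reach_head orbT.
  split.
  - by rewrite /tp; case: (w).
  - by case.
  - by move=> j; rewrite nth_behead.
apply: steps_add (run_steps [::] _ prog_wf).
split=> //; rewrite /= upd_id; split=> //=; congr (_, _, _, _).
apply: functional_extensionality => -[|i]; rewrite /upd /=.
  by congr pair; apply/ffunP => j; rewrite !ffunE.
rewrite /tp; case: (ltnP i (size w)) => iw.
  rewrite (nth_map true) //; congr pair; apply/ffunP => j; rewrite !ffunE /init_store.
  rewrite eq_inord //; case: eqP => // _; rewrite ?nth_nil //.
  by rewrite revK (nth_map true).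
rewrite nth_default ?size_map //; congr pair; apply/ffunP => j; rewrite !ffunE /init_store.
by case: eqP => // _; rewrite ?nth_nil // revK nth_default // size_map.
Qed.

Lemma decode_prefix_track (s : seq (sym K.+1)) bs :
  (forall i, track (nth (sym0 K.+1) s i) 1 = nth None (map Some bs) i) ->
  @decode_prefix M s = bs.
Proof.
elim: s bs => [|x s IH] bs h.
  by case: bs h => // b bs /(_ 0); rewrite /track ffunE.
rewrite /=; have := h 0; rewrite /= => ->.
by case: bs h => //= b bs h; rewrite (IH bs) // => i; apply: (h i.+1).
Qed.

Lemma run_halted w c : represents c ([::], Seek, 1, layout K.+1 (run prog (init_store w))) ->
  tm_halt (cfg_state (c : config M)) /\ cfg_output c = f w.
Proof.
case: c => [[[q l] h] r] [q1 q2 [h1 _ rr]]; split; first by rewrite /= q1 q2.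
rewrite /cfg_output; rewrite -progE; apply: decode_prefix_track => i.
rewrite -(track_layout (K := K.+1)) //; congr track.
by case: i => [|i]; rewrite /= -?h1 // -rr.
Qed.

Lemma cmd_poly_time_computable : poly_time_computable f.
Proof.
have halt w : tm_halt (cfg_state (tm_run M (2 + time prog (init_store w)) w)) /\
     cfg_output (tm_run M (2 + time prog (init_store w)) w) = f w.
  have [a ca sa] := init_steps w.
  by apply: run_halted; apply: represents_steps sa.
exists M; split; last first.
  move=> w t ht; have [h1 h2] := halt w; rewrite -h2 /tm_run.
  by rewrite -(halted_iter ht (leq_maxl t (2 + time prog (init_store w))))
    -(halted_iter h1 (leq_maxr t (2 + time prog (init_store w)))).
have [c hc] : exists c, forall n, 2 + g n * (2 * (n + g n).+1) <= c * n ^ c + c.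
  apply: poly_bounded_mono.
  have p1 := poly_bounded_add poly_bounded_id g_poly.
  have p2 := poly_bounded_add (poly_bounded_const 1) p1.
  have p3 := poly_bounded_mul (poly_bounded_const 2) p2.
  exact: (poly_bounded_add (poly_bounded_const 2) (poly_bounded_mul g_poly p3)).
exists c => w; rewrite /halts_within; have [h1 _] := halt w.
rewrite /tm_run (halted_iter h1) //; apply: leq_trans (hc _); rewrite leq_add2l.
have sw j : size (init_store w j) <= size w by rewrite /init_store; case: eqP => // _; rewrite size_rev.
apply: leq_trans (time_ops sw (leqnn _)) _.
by have := prog_ops w; nia.
Qed.

End CmdPoly.

(** * Tilings as string constraints *)

(* A literal schema refers to a variable by a pair (counter, tag) with tag < 8;
   under an environment giving the counters, that is the variable 8 * counter + tag. *)
Inductive schema :=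
  | ConstHas of seq nat & nat & nat
  | NonEmpty of nat & nat
  | VarHas of nat & nat & nat & nat.

(** Tags 0 to 3 are the representatives of cell [u] in the four roles, tag 4 is its diagonal word
    and tag 5 the word of the window starting at [u]. As 8 is a power of two, the binary form of an
    index is three tag bits followed by the bits of the counter, so printing it needs no
    arithmetic. *)
Definition vix (u r : nat) : nat := 8 * u + r.

Definition literal (e : nat -> nat) (l : schema) : bexp :=
  match l with
  | ConstHas s j r => BAtom (ACont (SConst s) (SVar (vix (e j) r)))
  | NonEmpty j r => BNot (BAtom (ACont (SConst [::]) (SVar (vix (e j) r))))
  | VarHas i q j r => BAtom (ACont (SVar (vix (e i) q)) (SVar (vix (e j) r)))
  end.

(** Counters 0, 1, 2 are the three consecutive cells of a window; counter 3 is the cell being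
    introduced. *)
Definition env (p q j : nat) : nat := nth 0 [:: p; p.+1; p.+2; q] j.

Lemma all_cons (T : Type) (P : pred T) x s : all P (x :: s) = P x && all P s.
Proof. by []. Qed.

Section Tiling.
Variable A : finType.

(* Four disjoint copies of [A], one for each role that a cell plays in a window. *)
Definition letter (r : nat) (a : A) : nat := r * #|A| + enum_rank a.
Definition sep : nat := 4 * #|A|.
Definition quad : Type := (A * A * A * A)%type.
Definition word (q : quad) : seq nat :=
  let: (a, b, c, d) := q in [:: letter 0 a; letter 1 b; letter 2 c; letter 3 d].
Definition quads_str (s : seq quad) : seq nat := flatten [seq rcons (word q) sep | q <- s].
Definition letters_str (r : nat) (K : pred A) : seq nat := [seq letter r a | a <- enum K].

Definition diag (q : quad) : bool :=
  let: (a, b, c, d) := q in [&& a == b, a == c & a == d].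

(** A cell takes part in several windows, each time in another role and hence in another copy of the
    alphabet. The diagonal word of [link_tpl] forces its four representatives to stand for the same
    element. *)
Definition link_role (r : nat) : seq schema :=
  [:: ConstHas (letters_str r predT) 3 r; NonEmpty 3 r; VarHas 3 4 3 r].
Definition link_tpl : seq schema :=
  ConstHas (quads_str (enum diag)) 3 4 :: flatten (map link_role (iota 0 4)).
Definition cell_tpl (K : pred A) : seq schema := ConstHas (letters_str 0 K) 3 0 :: link_tpl.
(** A window introduces the cell of counter 3 and so carries the links of that cell; the cells of
    the first row get theirs from [cell_tpl]. *)
Definition window_tpl (Q : pred quad) : seq schema :=
  [:: ConstHas (quads_str (enum Q)) 0 5, VarHas 0 5 0 0, VarHas 0 5 1 1,
      VarHas 0 5 2 2, VarHas 0 5 3 3 & link_tpl].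

Fixpoint cells (ks : seq (pred A)) (u : nat) : formula :=
  if ks is K :: ks' then map (literal (env 1 u)) (cell_tpl K) ++ cells ks' u.+1 else [::].

Fixpoint windows (Q : pred quad) (N v q : nat) : formula :=
  if N is N'.+1 then map (literal (env v q)) (window_tpl Q) ++ windows Q N' v.+1 q.+1
  else [::].

Definition bound_block : seq nat := [:: 1; 1; 1; 1; 4; 4; 0; 0].

(** Cells are numbered from 1, because [bits_vix] needs a positive counter; hence one more block of
    bounds than there are cells. *)
Definition tiling_instance (Q : pred quad) (ks : seq (pred A)) (N : nat) : instance :=
  Instance sep.+1 (cells ks 1 ++ windows Q N 1 (size ks).+1)
    (flatten (nseq (size ks + N).+1 bound_block)).

Definition tiling (Q : pred quad) (ks : seq (pred A)) (N : nat) (X : nat -> A) : Prop :=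
  (forall i, i < size ks -> nth xpredT ks i (X i.+1)) /\
  (forall v, v < N -> Q (X v.+1, X v.+2, X v.+3, X (v.+1 + size ks))).

Lemma letter_inj r r' a b : letter r a = letter r' b -> r = r' /\ a = b.
Proof.
rewrite /letter => E; have ra := ltn_ord (enum_rank a); have rb := ltn_ord (enum_rank b).
have A0 : 0 < #|A| by apply: leq_trans ra.
have rr : r = r'.
  by have := congr1 (divn^~ #|A|) E; rewrite /= !divnMDl // !divn_small // !addn0.
by split=> //; apply/enum_rank_inj/val_inj; move: E; rewrite rr => /addnI.
Qed.

Lemma letter_lt r a : r < 4 -> letter r a < sep.
Proof.
move=> r4; apply: (@leq_trans (r.+1 * #|A|)); last by rewrite leq_mul2r r4 orbT.
by rewrite mulSn addnC ltn_add2l.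
Qed.

Lemma mem_word q x : x \in word q -> x < sep.
Proof.
by case: q => [[[a b] c] d]; rewrite !inE => /or4P[] /eqP->; apply: letter_lt.
Qed.

Lemma infix1 (T : eqType) (x : T) s : infix [:: x] s = (x \in s).
Proof.
apply/infixP/idP => [[p [q ->]]|/splitPr[p q]]; first by rewrite mem_cat inE eqxx orbT.
by exists p, q.
Qed.

Lemma infix_sep (T : eqType) (y s1 s2 : seq T) x :
  x \notin y -> infix y (s1 ++ x :: s2) -> infix y s1 \/ infix y s2.
Proof.
move=> xy /infixP[p [q E]].
have E' : s1 ++ x :: s2 = p ++ (y ++ q) by rewrite E.
case: (leqP (size s1) (size p)) => h.
  case: (ltngtP (size s1) (size p)) h => // [lt|eq] _.
    right; have := congr1 (drop (size s1).+1) E'.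
    rewrite drop_cat ltnNge leqnSn /= subSnn /= drop0 drop_cat.
    case: ltnP => [_ ->|le ->]; apply/infixP; first by exists (drop (size s1).+1 p), q.
    by exists [::], q; rewrite (_ : _ - _ = 0) ?drop0 //; lia.
  have [_] := cat_size_inj eq E'.
  by case: y xy {E E'} => [|z y] /=; [left; apply: infix0s|rewrite inE negb_or => /andP[/eqP ne _] [/ne]].
left; have := congr1 (drop (size p)) E'; rewrite drop_cat h drop_size_cat // => E2.
apply/infixP; exists (take (size p) s1), (drop (size y) (drop (size p) s1)).
rewrite -{1}(cat_take_drop (size p) s1); congr (_ ++ _).
rewrite -{1}(cat_take_drop (size y) (drop (size p) s1)); congr (_ ++ _).
case: (leqP (size y) (size (drop (size p) s1))) => h2.
  by have := congr1 (take (size y)) E2; rewrite takel_cat // take_size_cat.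
(* Otherwise the occurrence reaches across [x], and this index of [y] holds [x]. *)
case/negP: xy; have := congr1 (nth x ^~ (size (drop (size p) s1))) E2.
by rewrite nth_cat ltnn subnn /= nth_cat h2 => ->; apply: mem_nth.
Qed.

(** The four letters are distinct, so by counting [y] has no others. It then avoids the separator
    and lies within one block, where the copy to which a letter belongs identifies its component;
    the order of the letters in [y] never matters. *)
Lemma infix_quads y s a b c d : size y <= 4 -> infix y (quads_str s) ->
  letter 0 a \in y -> letter 1 b \in y -> letter 2 c \in y -> letter 3 d \in y ->
  (a, b, c, d) \in s.
Proof.
move=> sy inf ya yb yc yd.
have uw : uniq (word (a, b, c, d)).
  by rewrite /= !inE !negb_or; do !(apply/andP; split) => //; apply/eqP => /letter_inj[].
have wy : {subset word (a, b, c, d) <= y}.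
  by move=> x; rewrite !inE => /or4P[] /eqP->.
have [szy yw] := uniq_min_size uw wy sy.
have memy x : x \in y -> x \in word (a, b, c, d) by rewrite yw.
have nsep : sep \notin y by apply/negP => /memy /mem_word; rewrite ltnn.
elim: s inf => [|q s IH].
  by rewrite infixs0 => /eqP y0; rewrite y0 in ya.
rewrite /quads_str /= cat_rcons => /(infix_sep nsep)[inf|/IH]; last by rewrite inE orbC => ->.
have sub := mem_infix inf.
move: (sub _ ya) (sub _ yb) (sub _ yc) (sub _ yd).
case: q {inf sub} => [[[a' b'] c'] d'] /=; rewrite !inE.
do 4!(case/or4P=> /eqP/letter_inj[// _ ->]); by rewrite eqxx.
Qed.

Lemma quads_infix q s : q \in s -> infix (word q) (quads_str s).
Proof.
case/splitPr=> s1 s2; rewrite /quads_str map_cat flatten_cat /= cat_rcons.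
by apply/infixP; eexists; eexists.
Qed.

Lemma cells_cons K ks u :
  cells (K :: ks) u = map (literal (env 1 u)) (cell_tpl K) ++ cells ks u.+1.
Proof. by []. Qed.

Lemma windowsS Q N v q :
  windows Q N.+1 v q = map (literal (env v q)) (window_tpl Q) ++ windows Q N v.+1 q.+1.
Proof. by []. Qed.

Lemma all_cells P ks u : all P (cells ks u) <->
  forall i, i < size ks -> all P (map (literal (env 1 (u + i))) (cell_tpl (nth xpredT ks i))).
Proof.
elim: ks u => // K ks IH u; rewrite cells_cons all_cat; split.
  by case/andP=> h /IH h2 [|i]; [rewrite addn0|rewrite addnS => /h2].
move=> h; apply/andP; split; first by have := h 0 isT; rewrite addn0.
by apply/IH => i ik; have := h i.+1 ik; rewrite addnS.
Qed.

Lemma all_windows P Q N v q : all P (windows Q N v q) <->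
  forall i, i < N -> all P (map (literal (env (v + i) (q + i))) (window_tpl Q)).
Proof.
elim: N v q => // N IH v q; rewrite windowsS all_cat; split.
  by case/andP=> h /IH h2 [|i]; [rewrite !addn0|rewrite !addnS => /h2].
move=> h; apply/andP; split; first by have := h 0 isT; rewrite !addn0.
by apply/IH => i ik; have := h i.+1 ik; rewrite !addnS.
Qed.

Lemma bounds_nth n i : i < size (flatten (nseq n bound_block)) ->
  nth 0 (flatten (nseq n bound_block)) i = nth 0 bound_block (i %% 8).
Proof.
elim: n i => // n IH i; rewrite [nseq _ _]/= [flatten _]/= => ii.
case: (ltnP i 8) => i8; first by rewrite modn_small //; do 8!case: i i8 ii => [//|i] i8 ii.
rewrite -(subnK i8) addnC modnDl.
have -> : nth 0 (bound_block ++ flatten (nseq n bound_block)) (8 + (i - 8))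
   = nth 0 (flatten (nseq n bound_block)) (i - 8).
  by rewrite nth_cat addKn.
by apply: IH; move: ii => /=; lia.
Qed.

Lemma size_bound_blocks n : size (flatten (nseq n bound_block)) = 8 * n.
Proof. by elim: n => //= n ->; lia. Qed.

Lemma infix_letters y r K : size y <= 1 -> y != [::] -> infix y (letters_str r K) ->
  exists2 a, K a & y = [:: letter r a].
Proof.
case: y => [|x [|]] // _ _; rewrite infix1 => /mapP[a]; rewrite mem_enum => Ka ->.
by exists a.
Qed.

Lemma letters_infix r a (K : pred A) : K a -> infix [:: letter r a] (letters_str r K).
Proof. by move=> Ka; rewrite infix1 map_f // mem_enum. Qed.

(** * Satisfying assignments versus tilings *)

Section SatTiling.
Variables (Q : pred quad) (ks : seq (pred A)) (N : nat) (a0 : A).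
(** With at least two cells in the first row, the third cell [v.+3] of every window still lies among
    the [size ks + N] cells that have bounds. *)
Hypothesis ks2 : 1 < size ks.

Let I := tiling_instance Q ks N.
Let bnds := flatten (nseq (size ks + N).+1 bound_block).

Lemma tiling_instance_wf : instance_wf I.
Proof.
have wf_letters r K : r < 4 -> all (fun x => x < sep.+1) (letters_str r K).
  by move=> r4; apply/allP => _ /mapP[a _ ->]; rewrite ltnS ltnW // letter_lt.
have wf_quads s : all (fun x => x < sep.+1) (quads_str s).
  apply/allP => x /flattenP[_ /mapP[q _ ->]]; rewrite mem_rcons inE => /predU1P[->//|].
  by move/mem_word => xs; rewrite ltnS ltnW.
have wf_link p q : q <= size ks + N ->
    all (bexp_wf sep.+1 (8 * (size ks + N).+1)) (map (literal (env p q)) link_tpl).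
  move=> qn; rewrite /= /vix /env /= !wf_letters // wf_quads /=.
  by do !(apply/andP; split) => //; lia.
rewrite /instance_wf -[inst_k _]/sep.+1 -[inst_bounds _]/bnds size_bound_blocks all_cat.
apply/andP; split.
  apply/all_cells => i ik; rewrite /cell_tpl map_cons all_cons wf_link; last by lia.
  by rewrite /= wf_letters // /vix /env /=; lia.
apply/all_windows => i iN; rewrite /window_tpl !map_cons.
rewrite 5!all_cons wf_link; last by lia.
by rewrite /= wf_quads /vix /env /=; do !(apply/andP; split) => //; lia.
Qed.

Lemma sat_link sigma p q :
  (forall i, i < 8 -> size (sigma (vix q i)) <= nth 0 bound_block i) ->
  all (bexp_val sigma) (map (literal (env p q)) link_tpl) ->
  exists a, forall r, r < 4 -> sigma (vix q r) = [:: letter r a].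
Proof.
move=> bnd; rewrite /= /env /=.
case/and5P=> dg l0 n0 v0 /and5P[l1 n1 v1 l2 /and5P[n2 v2 l3 n3 /andP[v3 _]]].
have [a _ ea] := infix_letters (bnd 0 isT) n0 l0.
have [b _ eb] := infix_letters (bnd 1 isT) n1 l1.
have [c _ ec] := infix_letters (bnd 2 isT) n2 l2.
have [d _ ed] := infix_letters (bnd 3 isT) n3 l3.
move: v0 v1 v2 v3; rewrite ea eb ec ed !infix1 => v0 v1 v2 v3.
have := infix_quads (bnd 4 isT) dg v0 v1 v2 v3.
rewrite mem_enum => /and3P[/eqP ab /eqP ac /eqP ad]; subst b c d.
by exists a => -[|[|[|[|]]]].
Qed.

Lemma sat_tiling : satisfiable I -> exists X, tiling Q ks N X.
Proof.
case=> sigma []; rewrite -[inst_bounds _]/bnds size_bound_blocks => bnd.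
rewrite all_cat => /andP[/all_cells cs /all_windows ws].
have bndu u r : r < 8 -> u <= size ks + N -> size (sigma (vix u r)) <= nth 0 bound_block r.
  move=> r8 un; have lt : vix u r < 8 * (size ks + N).+1 by rewrite /vix; lia.
  have [_] := bnd _ lt; rewrite bounds_nth ?size_bound_blocks //.
  by rewrite /vix mulnC modnMDl modn_small.
(* The representative for role 0 is decoded; [a0] can be returned only for indices outside the
   tiling. *)
pose X u := odflt a0 [pick a | sigma (vix u 0) == [:: letter 0 a]].
have XE u r : 0 < u -> u <= size ks + N -> r < 4 -> sigma (vix u r) = [:: letter r (X u)].
  move=> u0 un; have [p lk] : exists p, all (bexp_val sigma) (map (literal (env p u)) link_tpl).
    (* The links of a cell come from its first-row template, or else from the window that introduces
       it. *)
    case: (leqP u (size ks)) => uk.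
      exists 1; have := cs u.-1; rewrite add1n prednK // => /(_ uk).
      by rewrite map_cons all_cons => /andP[].
    exists (1 + (u - size ks).-1); have := ws (u - size ks).-1.
    rewrite (_ : (size ks).+1 + _ = u); last by lia.
    by rewrite !map_cons 5!all_cons => /(_ ltac:(lia)) /and5P[_ _ _ _ /andP[]].
  have [a sa] := sat_link (fun i i8 => bndu u i i8 un) lk.
  move=> r4; rewrite sa // /X; case: pickP => [b|/(_ a)]; rewrite sa ?eqxx //.
  by case/eqP=> /letter_inj[_ ->].
exists X; split=> [i ik|v vN].
  have := cs i ik; rewrite map_cons all_cons => /andP[+ _].
  rewrite /= /env /= XE ?infix1 //; try lia.
  by case/mapP=> a; rewrite mem_enum => Ka /letter_inj[_ ->].
have := ws v vN; rewrite !map_cons 5!all_cons => /and5P[w0 w1 w2 w3 /andP[w4 _]].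
move: w0 w1 w2 w3 w4; rewrite /= /env /= !add1n.
rewrite (XE _ 0) ?(XE _ 1) ?(XE _ 2) ?(XE _ 3) ?infix1 //; try lia.
move=> w0 w1 w2 w3 w4.
have := infix_quads _ w0 w1 w2 w3 w4; rewrite mem_enum.
rewrite (_ : v.+1 + size ks = (size ks).+1 + v); last by lia.
by apply; apply: bndu => //; lia.
Qed.

Lemma tiling_sat X : tiling Q ks N X -> satisfiable I.
Proof.
case=> tk tw.
pose quad_of u : quad := (X u, X u.+1, X u.+2, X (u + size ks)).
pose val u r := if r < 4 then [:: letter r (X u)] else
  if r == 4 then word (X u, X u, X u, X u) else
  if r == 5 then word (quad_of u) else [::].
pose sigma i := val (i %/ 8) (i %% 8).
have sE u r : r < 8 -> sigma (vix u r) = val u r.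
  by move=> r8; rewrite /sigma /vix mulnC divnMDl // modnMDl divn_small // modn_small // addn0.
have lk p q : all (bexp_val sigma) (map (literal (env p q)) link_tpl).
  rewrite /= /env /= !sE // /val /= -/(word (X q, X q, X q, X q)) quads_infix.
    by rewrite !letters_infix // !eqxx ?orbT.
  by rewrite mem_enum unfold_in /= !eqxx.
exists sigma; split=> [i ib|].
  rewrite -[inst_bounds _]/bnds bounds_nth // -[inst_k _]/sep.+1 /sigma /val.
  have r8 : i %% 8 < 8 by rewrite ltn_mod.
  have wlt q : all (fun x => x < sep.+1) (word q).
    by apply/allP => x /mem_word xs; rewrite ltnS ltnW.
  case: (ltnP (i %% 8) 4) => r4.
    split; first by rewrite /= andbT ltnS ltnW // letter_lt.
    by case: (i %% 8) r4 => [|[|[|[|]]]].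
  case: eqP => [->|_]; first by split; [apply: wlt|].
  by case: eqP => [->|_]; first by split; [apply: wlt|].
rewrite all_cat; apply/andP; split.
  apply/all_cells => i ik; rewrite map_cons all_cons lk andbT /= /env /= sE // /val /=.
  by apply: letters_infix; apply: tk.
apply/all_windows => i iN; rewrite !map_cons 5!all_cons lk andbT /= /env /= !sE //.
rewrite /val /= !add1n -/(word (X i.+1, X i.+2, X i.+3, X (i.+1 + size ks))) quads_infix; last first.
  by rewrite mem_enum; apply: tw.
by rewrite (_ : i.+1 + size ks = (size ks).+1 + i) ?eqxx ?orbT //; lia.
Qed.

End SatTiling.

End Tiling.

(** * Macros on stacks *)

Ltac store_eq :=
  apply: functional_extensionality => ?; rewrite /= /upd /=;
  repeat (case: eqP => ? //=); subst => //=; try lia.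

Ltac upd_cases := rewrite /= /upd /=; repeat (case: eqP => ? //=); subst => //=; try lia.

Lemma run_Seq a b s : run (Seq a b) s = run b (run a s).
Proof. by []. Qed.

Lemma run_Loop j f t s : run (Loop j f t) s = loop (run f) (run t) j (s j) s.
Proof. by []. Qed.

Lemma ops_Seq a b s : ops (Seq a b) s = (ops a s + ops b (run a s)).+1.
Proof. by []. Qed.

Lemma ops_Loop j f t s :
  ops (Loop j f t) s = loop_ops (run f) (run t) (ops f) (ops t) j (s j) s.
Proof. by []. Qed.

Fixpoint pushes (j : nat) (bs : seq bool) : cmd :=
  if bs is b :: bs' then Seq (Push j b) (pushes j bs') else Skip.

Lemma run_pushes j bs s : run (pushes j bs) s = upd s j (rev bs ++ s j).
Proof.
elim: bs s => [|b bs IH] s /=; first by rewrite upd_id.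
by rewrite IH rev_cons cat_rcons /upd eqxx; store_eq.
Qed.

Lemma ops_pushes j bs s : ops (pushes j bs) s = 2 * size bs + 1.
Proof. by elim: bs s => //= b bs IH s; rewrite IH; lia. Qed.

Lemma wf_pushes K j bs : j < K -> cmd_wf K (pushes j bs).
Proof. by move=> jK; elim: bs => //= b bs ->; rewrite jK. Qed.

Lemma mods_pushes i j bs : j != i -> mods i (pushes j bs) = false.
Proof. by move=> /negbTE ji; elim: bs => //= b bs ->; rewrite ji. Qed.

Definition pour (i j : nat) : cmd := Loop i (Push j false) (Push j true).

Lemma run_pour i j s : i != j -> run (pour i j) s = upd (upd s i [::]) j (rev (s i) ++ s j).
Proof.
move=> /eqP ij /=; move: {2 3 4}(s i) (erefl (s i)) => l.
elim: l s => [|b l IH] s si /=; first by store_eq.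
rewrite IH; last by case: b si => _; rewrite /upd /=; case: eqP => //; rewrite eqxx.
by rewrite rev_cons cat_rcons; case: b si => _; store_eq.
Qed.

Lemma ops_pour i j s : ops (pour i j) s = 2 * size (s i) + 1.
Proof. by rewrite /=; move: (s i) => l; elim: l s => //= -[] l IH s; rewrite IH; lia. Qed.

(* Stacks 2 and 3 are scratch space, empty between macros. *)
Definition print (j dst : nat) : cmd :=
  Seq (Loop j (Seq (Push 2 false) (pushes dst [:: false; false]))
              (Seq (Push 2 true) (pushes dst [:: true; true])))
      (pour 2 j).

Lemma run_print j dst s : j != 2 -> dst != 2 -> j != dst -> s 2 = [::] ->
  run (print j dst) s = upd s dst (rev (dbl (s j)) ++ s dst).
Proof.
move=> /eqP j2 /eqP d2 /eqP jd s2; rewrite /print run_Seq run_Loop.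
set f := (X in loop X _ _ _ _); set t := (X in loop _ X _ _ _).
have E l s' : s' j = l -> loop f t j l s' =
   upd (upd (upd s' j [::]) 2 (rev l ++ s' 2)) dst (rev (dbl l) ++ s' dst).
  elim: l s' => [|b l IH] s' sj; first by rewrite /=; store_eq.
  rewrite [loop _ _ _ _ _]/= IH; last first.
    by rewrite /f /t /=; case: b sj => sj; upd_cases.
  rewrite /dbl /= -/(dbl l) !rev_cons !cat_rcons.
  by case: b sj => _; rewrite /f /t; store_eq.
rewrite E // run_pour; last by rewrite eq_sym; apply/eqP.
by rewrite s2; store_eq; rewrite ?cats0 ?revK.
Qed.

Lemma ops_print j dst s : j != 2 -> dst != 2 -> j != dst -> s 2 = [::] ->
  ops (print j dst) s <= 10 * size (s j) + 5.
Proof.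
move=> /eqP j2 /eqP d2 /eqP jd s2.
rewrite /print ops_Seq ops_Loop ops_pour run_Loop.
set f := Seq (Push 2 false) _; set t := Seq (Push 2 true) _.
pose I (l : seq bool) (s' : store) := size (s' 2) + size l = size (s j).
have step b l s' : I (b :: l) s' -> I l ((if b then run t else run f) (upd s' j l)) /\
    (if b then ops t else ops f) (upd s' j l) <= 7.
  by rewrite /I; case: b => /= <-; split=> //; upd_cases.
have I0 : I (s j) s by rewrite /I s2.
have := loop_ops_inv step I0; have := loop_inv (fun b l s' h => (step b l s' h).1) I0.
by rewrite /I /=; lia.
Qed.

Lemma wf_print K j dst : j < K -> dst < K -> 2 < K -> j != 2 -> dst != 2 -> j != dst ->
  cmd_wf K (print j dst).
Proof.
by move=> jK dK K2 j2 d2 jd; rewrite /= jK dK K2; lia.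
Qed.

Lemma mods_print i j dst : i != 2 -> i != j -> i != dst -> mods i (print j dst) = false.
Proof. by rewrite /=; lia. Qed.

(** Stack 3 is the carry, one bit when set and empty otherwise; stack 2 collects the new digits,
    starting with the least significant. *)
Definition incr (j : nat) : cmd :=
  Seq (Push 3 true)
  (Seq (Loop j (If 3 (Push 2 true) (Push 2 false))
               (If 3 (Seq (Push 2 false) (Push 3 true)) (Push 2 true)))
  (Seq (If 3 (Push 2 true) Skip) (pour 2 j))).

Lemma run_incr j s : 3 < j -> s 2 = [::] -> s 3 = [::] ->
  run (incr j) s = upd s j (incb (s j)).
Proof.
move=> j3 s2 s3; rewrite /incr !run_Seq run_Loop.
set f := (X in loop X _ _ _ _); set t := (X in loop _ X _ _ _).
have u3 l s' : upd s' j l 3 = s' 3 by rewrite /upd ifN //; lia.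
have F0 l s' : s' 3 = [::] -> f (upd s' j l) = upd (upd s' j l) 2 (false :: s' 2).
  by move=> s3'; rewrite /f /= u3 s3'; store_eq.
have T0 l s' : s' 3 = [::] -> t (upd s' j l) = upd (upd s' j l) 2 (true :: s' 2).
  by move=> s3'; rewrite /t /= u3 s3'; store_eq.
have F1 l s' : s' 3 = [:: true] ->
    f (upd s' j l) = upd (upd (upd s' j l) 3 [::]) 2 (true :: s' 2).
  by move=> s3'; rewrite /f /= u3 s3'; store_eq.
have T1 l s' : s' 3 = [:: true] -> t (upd s' j l) = upd (upd s' j l) 2 (false :: s' 2).
  by move=> s3'; rewrite /t /= u3 s3'; store_eq.
have E0 l s' : s' 3 = [::] -> s' j = l ->
    loop f t j l s' = upd (upd s' j [::]) 2 (rev l ++ s' 2).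
  elim: l s' => [|b l IH] s' s3' sj; first by rewrite /=; store_eq.
  have -> : loop f t j (b :: l) s' = loop f t j l (upd (upd s' j l) 2 (b :: s' 2)).
    by case: b sj => sj /=; rewrite ?T0 ?F0.
  by rewrite IH ?rev_cons ?cat_rcons; [store_eq|upd_cases|upd_cases].
have E1 l s' : s' 3 = [:: true] -> s' j = l ->
    run (If 3 (Push 2 true) Skip) (loop f t j l s') =
    upd (upd (upd s' j [::]) 2 (rev (incb l) ++ s' 2)) 3 [::].
  elim: l s' => [|[] l IH] s' s3' sj; first by rewrite /= s3'; store_eq.
    rewrite [loop _ _ _ _ _]/= T1 // IH ?rev_cons ?cat_rcons; [store_eq|upd_cases|upd_cases].
  rewrite [loop _ _ _ _ _]/= F1 // E0 ?rev_cons ?cat_rcons; [store_eq|upd_cases|upd_cases].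
rewrite E1 //; last first.
  by rewrite /upd /= s3.
rewrite run_pour; last by lia.
by store_eq; rewrite ?s2 ?s3 ?cats0 ?revK.
Qed.

Lemma ops_incr j s : 3 < j -> s 2 = [::] -> s 3 = [::] ->
  ops (incr j) s <= 10 * size (s j) + 20.
Proof.
move=> j3 s2 s3; rewrite /incr !ops_Seq ops_Loop ops_pour run_Loop.
set f := If 3 (Push 2 true) (Push 2 false).
set t := If 3 (Seq (Push 2 false) (Push 3 true)) (Push 2 true).
set c := If 3 (Push 2 true) Skip.
pose I (l : seq bool) (s' : store) :=
  size (s' 2) + size l <= size (s j) /\ size (s' 3) <= 1.
have step b l s' : I (b :: l) s' -> I l ((if b then run t else run f) (upd s' j l)) /\
    (if b then ops t else ops f) (upd s' j l) <= 4.
  case=> /= h1 h2; have u3 : upd s' j l 3 = s' 3 by rewrite /upd ifN //; lia.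
  case E3: (s' 3) h2 => [|x [|]] //= _;
    by case: b; rewrite /I /= u3 E3; do !split=> //; upd_cases; rewrite ?E3 /=; lia.
have sE : run (Push 3 true) s j = s j by upd_cases.
have I0 : I (s j) (run (Push 3 true) s).
  by rewrite /I; split; upd_cases; rewrite ?s2 ?s3.
have := loop_ops_inv step I0; have := loop_inv (fun b l s' h => (step b l s' h).1) I0.
rewrite sE; set s1 := loop _ _ _ _ _; case; rewrite addn0 => z1 z2 z3.
have : size (run c s1 2) <= (size (s1 2)).+1.
  by rewrite /c /=; case: (s1 3) z2 => [|x l] //= _; upd_cases.
have : ops c s1 <= 3 by rewrite /c /=; case: (s1 3).
have : ops (Push 3 true) s = 1 by [].
by lia.
Qed.

Lemma wf_incr K j : j < K -> 3 < j -> cmd_wf K (incr j).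
Proof. by move=> jK j3; rewrite /= jK; lia. Qed.

Lemma mods_incr i j : i != 2 -> i != 3 -> i != j -> mods i (incr j) = false.
Proof. by rewrite /=; lia. Qed.

(* Counter [j] of an environment lives in stack [4 + j]. *)
Inductive token := TNum of nat | TVar of nat & nat.

Definition token_val (e : nat -> nat) (k : token) : nat :=
  match k with TNum n => n | TVar j r => vix (e j) r end.

Definition token_ok (k : token) : bool :=
  match k with TNum _ => true | TVar j r => (j < 4) && (r < 8) end.

Definition tag_bits (r : nat) : seq bool := [:: odd r; odd r./2; odd r./2./2].

Lemma bits_vix u r : 0 < u -> r < 8 -> bits (vix u r) = tag_bits r ++ bits u.
Proof.
move=> u0 r8; rewrite /vix.
rewrite (_ : 8 * u + r = odd r + (odd r./2 + (odd r./2./2 + u.*2).*2).*2).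
  by rewrite !bits_double //; lia.
by case: r r8 => [|[|[|[|[|[|[|[|]]]]]]]] //= _; lia.
Qed.

Definition emit_token (dst : nat) (k : token) : cmd :=
  match k with
  | TNum n => pushes dst (enc_nat n)
  | TVar j r => Seq (pushes dst (dbl (tag_bits r)))
                 (Seq (print (4 + j) dst) (pushes dst [:: false; true]))
  end.

Fixpoint emit_tokens (dst : nat) (ks : seq token) : cmd :=
  if ks is k :: ks' then Seq (emit_token dst k) (emit_tokens dst ks') else Skip.

Definition counters (e : nat -> nat) (s : store) : Prop :=
  forall j, j < 4 -> s (4 + j) = bits (e j) /\ 0 < e j.

Definition spec (c : cmd) (s s' : store) (n : nat) : Prop := run c s = s' /\ ops c s <= n.

Lemma spec_Seq a b s s1 s2 n1 n2 :
  spec a s s1 n1 -> spec b s1 s2 n2 -> spec (Seq a b) s s2 (n1 + n2).+1.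
Proof.
by move=> [h1 l1] [h2 l2]; split; rewrite ?run_Seq ?ops_Seq h1 // ltnS leq_add.
Qed.

Lemma spec_eq c s s1 s2 n1 n2 : spec c s s1 n1 -> s1 = s2 -> n1 <= n2 -> spec c s s2 n2.
Proof. by move=> [h l] <- h2; split=> //; apply: leq_trans h2. Qed.

Lemma spec_Push j b s : spec (Push j b) s (upd s j (b :: s j)) 1.
Proof. by []. Qed.

(** [St l1 l2] is the state once [l1] has been consumed and [l2] remains; describing the states in
    this form makes a loop invariant a plain family of stores. *)
Lemma spec_Loop j f t (St : seq bool -> seq bool -> store) l0 n :
  St [::] l0 j = l0 ->
  (forall l1 b l2, l0 = l1 ++ b :: l2 ->
     spec (if b then t else f) (upd (St l1 (b :: l2)) j l2) (St (rcons l1 b) l2) n) ->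
  spec (Loop j f t) (St [::] l0) (St l0 [::]) (size l0 * n.+1 + 1).
Proof.
move=> j0 step; rewrite /spec run_Loop ops_Loop j0.
suff H l1 l : l0 = l1 ++ l -> loop (run f) (run t) j l (St l1 l) = St l0 [::] /\
    loop_ops (run f) (run t) (ops f) (ops t) j l (St l1 l) <= size l * n.+1 + 1.
  exact: (H [::]).
elim: l l1 => [|b l IH] l1 E; first by rewrite E cats0.
have [h1 h2] := step _ _ _ E; have := IH (rcons l1 b); rewrite cat_rcons => /(_ E)[h3 h4].
have -> : loop (run f) (run t) j (b :: l) (St l1 (b :: l)) =
    loop (run f) (run t) j l (run (if b then t else f) (upd (St l1 (b :: l)) j l)).
  by case: (b).
have -> : loop_ops (run f) (run t) (ops f) (ops t) j (b :: l) (St l1 (b :: l)) =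
    (ops (if b then t else f) (upd (St l1 (b :: l)) j l)).+1 +
    loop_ops (run f) (run t) (ops f) (ops t) j l
      (run (if b then t else f) (upd (St l1 (b :: l)) j l)).
  by case: (b).
by rewrite h1; split=> //=; lia.
Qed.

Lemma spec_pushes j bs s : spec (pushes j bs) s (upd s j (rev bs ++ s j)) (2 * size bs + 1).
Proof. by split; rewrite ?run_pushes ?ops_pushes. Qed.

Lemma spec_pour i j s : i != j ->
  spec (pour i j) s (upd (upd s i [::]) j (rev (s i) ++ s j)) (2 * size (s i) + 1).
Proof. by move=> ij; split; rewrite ?run_pour ?ops_pour. Qed.

Lemma spec_print j dst s : j != 2 -> dst != 2 -> j != dst -> s 2 = [::] ->
  spec (print j dst) s (upd s dst (rev (dbl (s j)) ++ s dst)) (10 * size (s j) + 5).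
Proof. by move=> *; split; [apply: run_print|apply: ops_print]. Qed.

Lemma spec_incr j s : 3 < j -> s 2 = [::] -> s 3 = [::] ->
  spec (incr j) s (upd s j (incb (s j))) (10 * size (s j) + 20).
Proof. by move=> *; split; [apply: run_incr|apply: ops_incr]. Qed.

Lemma upd_upd (T : Type) (s : nat -> T) j u v : upd (upd s j u) j v = upd s j v.
Proof. by store_eq. Qed.

Lemma upd_eq (T : Type) (s : nat -> T) j v : upd s j v j = v.
Proof. by rewrite /upd eqxx. Qed.

Lemma upd_ne (T : Type) (s : nat -> T) i j v : i != j -> upd s j v i = s i.
Proof. by rewrite /upd => /negbTE->. Qed.

Definition token_cost (k : token) : nat :=
  match k with TNum n => 2 * size (enc_nat n) + 1 | TVar _ _ => 40 end.

(** [B] bounds the counters. The bit length of a counter is bounded by its value, which is crude but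
    enough since all counters stay polynomial. The condition on [dst] keeps it apart from the
    scratch stacks and the counters. *)
Lemma spec_emit_token dst e k s B : counters e s -> s 2 = [::] -> 7 < dst \/ dst = 1 ->
  (forall j, j < 4 -> e j <= B) -> token_ok k ->
  spec (emit_token dst k) s (upd s dst (rev (enc_nat (token_val e k)) ++ s dst))
    (token_cost k * B.+1).
Proof.
move=> cs s2 d7 eB; case: k => [n|j r] ok.
  by apply: spec_eq (spec_pushes _ _ _) _ _ => //=; rewrite leq_pmulr.
case/andP: ok => j4 r8; have [sj ej] := cs _ j4.
have d4 : 4 + j != dst by lia.
have d2 : 2 != dst by lia.
apply: spec_eq.
  apply: spec_Seq (spec_pushes _ _ _) (spec_Seq (spec_print _ _ _ _) (spec_pushes _ _ _)).
  - by lia.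
  - by lia.
  - by lia.
  - by rewrite upd_ne.
- rewrite !upd_eq !(upd_ne _ _ d4) !upd_upd sj; congr upd.
  by rewrite !catA -!rev_cat /enc_nat bits_vix // /dbl map_cat flatten_cat -!catA.
- rewrite upd_ne // sj.
  by have := size_bits (e j); have := eB _ j4; rewrite /=; lia.
Qed.

Definition tokens_cost (ks : seq token) : nat := \sum_(k <- ks) (token_cost k).+1 + 1.

Lemma spec_emit_tokens dst e ks s B : counters e s -> s 2 = [::] -> 7 < dst \/ dst = 1 ->
  (forall j, j < 4 -> e j <= B) -> all token_ok ks ->
  spec (emit_tokens dst ks) s (upd s dst (rev (enc_nats (map (token_val e) ks)) ++ s dst))
    (tokens_cost ks * B.+1).
Proof.
move=> cs s2 d7 eB; elim: ks s cs s2 => [|k ks IH] s cs s2.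
  by move=> _; split; rewrite ?upd_id //= /tokens_cost big_nil; lia.
case/andP=> k1 k2.
apply: spec_eq (spec_Seq (spec_emit_token cs s2 d7 eB k1) (IH _ _ _ k2)) _ _.
- by move=> j j4; rewrite upd_ne; [apply: cs|lia].
- by rewrite upd_ne //; lia.
- by rewrite upd_upd upd_eq catA -rev_cat.
- by rewrite /tokens_cost big_cons; nia.
Qed.

(** * Printing the formula *)

Arguments run : simpl never.
Arguments ops : simpl never.
Arguments bits : simpl never.

Definition schema_tokens (l : schema) : seq token :=
  match l with
  | ConstHas s j r => map TNum [:: 3, 1, 1, size s & s] ++ [:: TNum 0; TVar j r]
  | NonEmpty j r => map TNum [:: 2; 3; 1; 1; 0; 0] ++ [:: TVar j r]
  | VarHas i q j r => [:: TNum 3; TNum 1; TNum 0; TVar i q; TNum 0; TVar j r]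
  end.

Definition schema_ok (l : schema) : bool :=
  match l with
  | ConstHas _ j r | NonEmpty j r => (j < 4) && (r < 8)
  | VarHas i q j r => [&& i < 4, q < 8, j < 4 & r < 8]
  end.

Lemma schema_tokensE e l : map (token_val e) (schema_tokens l) = ser_bexp (literal e l).
Proof.
case: l => [s j r|j r|i q j r] //=.
by rewrite map_cat -map_comp (@eq_map _ _ _ id) ?map_id.
Qed.

Lemma schema_tokens_ok l : schema_ok l -> all token_ok (schema_tokens l).
Proof.
case: l => [s j r|j r|i q j r] /=.
- by move=> jr; rewrite all_cat /= jr !andbT all_map; apply/allP.
- by move=> ->.
- by case/and4P=> -> -> -> ->.
Qed.

Definition ser_formula (phi : formula) : seq bool := enc_nats (flatten (map ser_bexp phi)).

Lemma ser_formula_rcons phi e : ser_formula (rcons phi e) = ser_formula phi ++ enc_nats (ser_bexp e).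
Proof. by rewrite /ser_formula map_rcons -cats1 flatten_cat enc_nats_cat /= cats0. Qed.

(** In the code of an instance the number of literals precedes the formula but is known only at the
    end, so stack 8 counts them while stack 9 buffers the formula in reverse. Stack 10 keeps [q] in
    unary: its final value is the number of bound blocks. *)
Definition cst (rho : store) (p q : nat) (phi : formula) : store := fun i =>
  match i with
  | 2 | 3 => [::]
  | 4 => bits p | 5 => bits p.+1 | 6 => bits p.+2 | 7 => bits q
  | 8 => bits (size phi)
  | 9 => rev (ser_formula phi)
  | 10 => nseq q true
  | _ => rho i
  end.

Lemma upd_cst rho p q phi j v : 10 < j ->
  upd (cst rho p q phi) j v = cst (upd rho j v) p q phi.
Proof.
move=> j10; apply: functional_extensionality => i; rewrite /upd.
case: eqP => [->|ne]; first by rewrite -[LHS](upd_eq rho j); case: j j10 => [|[|[|[|[|[|[|[|[|[|[|j]]]]]]]]]]].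
have e k : k != j -> rho k = upd rho j v k by move=> kj; rewrite upd_ne.
by case: i ne => [|[|[|[|[|[|[|[|[|[|[|i]]]]]]]]]]] ne //; apply: e; apply/eqP.
Qed.

Lemma cst_ge rho p q phi j : 10 < j -> cst rho p q phi j = rho j.
Proof. by case: j => [|[|[|[|[|[|[|[|[|[|[|j]]]]]]]]]]]. Qed.

Lemma counters_cst rho p q phi : 0 < p -> 0 < q -> counters (env p q) (cst rho p q phi).
Proof. by move=> p0 q0 [|[|[|[|]]]]. Qed.

Definition emit_schema (l : schema) : cmd :=
  Seq (emit_tokens 9 (schema_tokens l)) (incr 8).

(** [201] absorbs the increment of stack 8, at most [180 * B + 20] operations when
    [size phi <= 18 * B]. *)
Definition schema_cost (l : schema) : nat := tokens_cost (schema_tokens l) + 201.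

Lemma size_bits_le n B : n <= B -> size (bits n) <= B.
Proof. exact: leq_trans (size_bits n). Qed.

(** The factor 18 is the number of literals of a window; a first-row cell has 14, so [18 * q]
    dominates the literals printed for the cells introduced so far. *)
Lemma spec_emit_schema rho p q phi l B : 0 < p -> 0 < q -> p.+2 <= B -> q <= B ->
  size phi <= 18 * B -> schema_ok l ->
  spec (emit_schema l) (cst rho p q phi)
    (cst rho p q (rcons phi (literal (env p q) l))) (schema_cost l * B.+1).
Proof.
move=> p0 q0 pB qB phiB ok; have cs := counters_cst rho phi p0 q0.
have eB j : j < 4 -> env p q j <= B by rewrite /env; case: j => [|[|[|[|]]]] //= _; lia.
have s1 := spec_emit_tokens cs erefl (or_introl (isT : 7 < 9)) eB (schema_tokens_ok ok).
apply: spec_eq (spec_Seq s1 (@spec_incr 8 _ _ _ _)) _ _ => //.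
  rewrite schema_tokensE; apply: functional_extensionality => i.
  do 11?[case: i => [|i] //].
    by rewrite /upd /= size_rcons bits_incb.
  by rewrite /upd /= ser_formula_rcons rev_cat.
rewrite /schema_cost upd_ne // /cst mulnDl.
by have := size_bits_le phiB; lia.
Qed.

Fixpoint emit_tpl (ls : seq schema) : cmd :=
  if ls is l :: ls' then Seq (emit_schema l) (emit_tpl ls') else Skip.

Definition tpl_cost (ls : seq schema) : nat := \sum_(l <- ls) (schema_cost l).+1 + 1.

Lemma spec_emit_tpl rho p q phi ls B : 0 < p -> 0 < q -> p.+2 <= B -> q <= B ->
  size phi + size ls <= 18 * B -> all schema_ok ls ->
  spec (emit_tpl ls) (cst rho p q phi)
    (cst rho p q (phi ++ map (literal (env p q)) ls)) (tpl_cost ls * B.+1).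
Proof.
move=> p0 q0 pB qB; elim: ls phi => [|l ls IH] phi /= phiB.
  by move=> _; split; rewrite ?cats0 // /tpl_cost big_nil /ops; lia.
case/andP=> l1 l2.
apply: spec_eq (spec_Seq (spec_emit_schema rho p0 q0 pB qB _ l1) (IH _ _ l2)) _ _.
- by lia.
- by rewrite size_rcons; lia.
- by rewrite cat_rcons.
- by rewrite /tpl_cost big_cons; nia.
Qed.

(** * Programs printing the cells and the windows *)

Section Cells.
Variable A : finType.
Implicit Types (K : pred A) (Q : pred (quad A)).

Definition cell K : cmd := Seq (emit_tpl (cell_tpl K)) (Seq (incr 7) (Push 10 true)).
Definition window Q : cmd :=
  Seq (emit_tpl (window_tpl Q))
    (Seq (incr 4) (Seq (incr 5) (Seq (incr 6) (Seq (incr 7) (Push 10 true))))).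

Lemma spec_cell K rho q phi B : 0 < q -> 3 <= B -> q.+1 <= B -> size phi + 18 <= 18 * q ->
  spec (cell K) (cst rho 1 q phi)
    (cst rho 1 q.+1 (phi ++ map (literal (env 1 q)) (cell_tpl K)))
    ((tpl_cost (cell_tpl K) + 25) * B.+1).
Proof.
move=> q0 B3 qB phiq.
have szt : size (cell_tpl K) = 14 by [].
have h1 : spec (emit_tpl (cell_tpl K)) (cst rho 1 q phi) _ _ :=
  @spec_emit_tpl rho 1 q phi (cell_tpl K) B isT q0 B3 (ltnW qB) ltac:(lia) isT.
have h2 := spec_Seq h1 (spec_Seq (@spec_incr 7 _ isT erefl erefl) (spec_Push 10 true _)).
apply: spec_eq h2 _ _.
- apply: functional_extensionality => i.
  do 11?[case: i => [|i] //]; by rewrite /upd /= bits_incb.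
- by have := size_bits q; rewrite {1}/cst; nia.
Qed.

Lemma spec_window Q rho p q phi B : 0 < p -> 0 < q -> p.+2 <= B -> q.+1 <= B ->
  size phi + 18 <= 18 * q ->
  spec (window Q) (cst rho p q phi)
    (cst rho p.+1 q.+1 (phi ++ map (literal (env p q)) (window_tpl Q)))
    ((tpl_cost (window_tpl Q) + 100) * B.+1).
Proof.
move=> p0 q0 pB qB phiq.
have szt : size (window_tpl Q) = 18 by [].
have h1 : spec (emit_tpl (window_tpl Q)) (cst rho p q phi) _ _ :=
  @spec_emit_tpl rho p q phi (window_tpl Q) B p0 q0 pB (ltnW qB) ltac:(lia) isT.
have h2 := spec_Seq h1 (spec_Seq (@spec_incr 4 _ isT erefl erefl)
  (spec_Seq (@spec_incr 5 _ isT erefl erefl) (spec_Seq (@spec_incr 6 _ isT erefl erefl)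
  (spec_Seq (@spec_incr 7 _ isT erefl erefl) (spec_Push 10 true _))))).
apply: spec_eq h2 _ _.
- apply: functional_extensionality => i.
  do 11?[case: i => [|i] //]; by rewrite /upd /= bits_incb.
- have b0 : size (bits p) <= B by apply: size_bits_le; lia.
  have b1 : size (bits p.+1) <= B by apply: size_bits_le; lia.
  have b2 : size (bits p.+2) <= B by apply: size_bits_le; lia.
  have b3 : size (bits q) <= B by apply: size_bits_le; lia.
  by rewrite !upd_ne // !mulnDl; cbv beta iota delta [cst]; lia.
Qed.

(** Quantifying over [q] and [phi] makes pieces of the first row composable. The window counter
    rests at 1 meanwhile, which is where [3 <= B] comes from. *)
Definition emits (c : cmd) (rho rho' : store) (ks : seq (pred A)) (k : nat) : Prop :=
  forall q phi B, 0 < q -> 3 <= B -> q + size ks <= B -> size phi + 18 <= 18 * q ->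
  spec c (cst rho 1 q phi) (cst rho' 1 (q + size ks) (phi ++ cells ks q)) (k * B.+1).

Lemma cells_cat (ks1 ks2 : seq (pred A)) u :
  cells (ks1 ++ ks2) u = cells ks1 u ++ cells ks2 (u + size ks1).
Proof.
elim: ks1 u => [|K ks IH] u; first by rewrite addn0.
by rewrite cat_cons !cells_cons IH catA addSnnS.
Qed.

Lemma size_cells (ks : seq (pred A)) u : size (cells ks u) = 14 * size ks.
Proof. by elim: ks u => [|K ks IH] u; rewrite ?muln0 // cells_cons size_cat IH size_map mulnS. Qed.

Lemma windows_cat Q N M v q :
  windows Q (N + M) v q = windows Q N v q ++ windows Q M (v + N) (q + N).
Proof.
elim: N v q => [|N IH] v q; first by rewrite !addn0.
by rewrite addSn !windowsS IH catA !addSnnS.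
Qed.

Lemma size_windows Q N v q : size (windows Q N v q) = 18 * N.
Proof. by elim: N v q => [|N IH] v q; rewrite ?muln0 // windowsS size_cat IH size_map mulnS. Qed.

Lemma emits_cell K rho : emits (cell K) rho rho [:: K] (tpl_cost (cell_tpl K) + 25).
Proof.
move=> q phi B q0 B3 qB phiq.
rewrite addn1 in qB *; apply: spec_eq (spec_cell _ _ q0 B3 qB phiq) _ (leqnn _).
by rewrite cells_cons cats0.
Qed.

Lemma emits_Seq a b rho rho1 rho2 ks1 ks2 k1 k2 :
  emits a rho rho1 ks1 k1 -> emits b rho1 rho2 ks2 k2 ->
  emits (Seq a b) rho rho2 (ks1 ++ ks2) (k1 + k2).+1.
Proof.
move=> h1 h2 q phi B q0 B3; rewrite size_cat => qB phiq.
have s1 := h1 q phi B q0 B3 ltac:(lia) phiq.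
have s2 := h2 (q + size ks1) (phi ++ cells ks1 q) B ltac:(lia) B3 ltac:(lia).
apply: spec_eq (spec_Seq s1 (s2 _)) _ _.
- by rewrite size_cat size_cells; lia.
- by rewrite cells_cat catA addnA.
- by rewrite mulSn mulnDl; lia.
Qed.

Lemma emits_Loop j f t rho ksf kst k :
  (forall rho, emits f rho rho ksf k) -> (forall rho, emits t rho rho kst k) -> 10 < j ->
  emits (Loop j f t) rho (upd rho j [::])
    (flatten [seq if b then kst else ksf | b <- rho j]) (size (rho j) * k.+1 + 1).
Proof.
move=> hf ht j10; set ks := flatten _ => q phi B q0 B3 qB phiq.
pose kl l := flatten [seq if b then kst else ksf | b <- l].
pose St (l1 l2 : seq bool) :=
  cst (upd rho j l2) 1 (q + size (kl l1)) (phi ++ cells (kl l1) q).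
have S0 : St [::] (rho j) = cst rho 1 q phi by rewrite /St /= addn0 cats0 upd_id.
have S1 : St (rho j) [::] = cst (upd rho j [::]) 1 (q + size ks) (phi ++ cells ks q) by [].
rewrite -S0 -S1; apply: (@spec_eq _ _ _ _ (size (rho j) * (k * B.+1).+1 + 1)) => //; last first.
  rewrite (mulnS _ (k * _)) (mulnS _ k) !mulnDl mul1n mulnA.
  by have := leq_pmulr (size (rho j)) (ltn0Sn B); lia.
apply: spec_Loop; first by rewrite /St cst_ge // upd_eq.
move=> l1 b l2 E; rewrite /St upd_cst // upd_upd.
have klE : kl (rcons l1 b) = kl l1 ++ (if b then kst else ksf).
  by rewrite /kl map_rcons -cats1 flatten_cat /= cats0.
have szk : size (kl l1) + size (if b then kst else ksf) <= size ks.
  rewrite -size_cat -klE /ks E -cat_rcons map_cat flatten_cat size_cat; exact: leq_addr.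
rewrite klE size_cat addnA cells_cat catA.
by case: b {E klE} szk => szk; [apply: ht|apply: hf] => //; rewrite ?size_cat ?size_cells; lia.
Qed.

(** Stack 13 must survive for the next round of an outer loop: its bits move to stack 14 and are
    poured back, which also restores their order. *)
Definition window_block Q : cmd :=
  Seq (Loop 13 (Seq (window Q) (Push 14 false)) (Seq (window Q) (Push 14 true))) (pour 14 13).

Definition window_cost Q : nat := tpl_cost (window_tpl Q) + 100.

Lemma spec_window_block Q rho p q phi B (l := rho 13) :
  rho 14 = [::] -> 0 < p -> p.+1 < q -> q + size l <= B -> size phi + 18 <= 18 * q ->
  spec (window_block Q) (cst rho p q phi)
    (cst rho (p + size l) (q + size l) (phi ++ windows Q (size l) p q))
    ((size l).+1 * (window_cost Q + 6) * B.+1).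
Proof.
move=> r14 p0 pq qB phiq.
pose St (l1 l2 : seq bool) := cst (upd (upd rho 13 l2) 14 (rev l1))
  (p + size l1) (q + size l1) (phi ++ windows Q (size l1) p q).
have S0 : St [::] l = cst rho p q phi.
  by rewrite /St /= !addn0 cats0 /l upd_id -[X in upd _ _ X]r14 upd_id.
have s1 : spec (Loop 13 (Seq (window Q) (Push 14 false)) (Seq (window Q) (Push 14 true)))
   (St [::] l) (St l [::]) (size l * (window_cost Q * B.+1 + 2).+1 + 1).
  apply: spec_Loop; first by rewrite /St cst_ge.
  move=> l1 b l2 E; have szl : size l1 < size l by rewrite E size_cat /=; lia.
  rewrite /St upd_cst //.
  have -> : upd (upd (upd rho 13 (b :: l2)) 14 (rev l1)) 13 l2 =
     upd (upd rho 13 l2) 14 (rev l1) by store_eq.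
  have sw : spec (Seq (window Q) (Push 14 b)) _ _ _ :=
    spec_Seq (@spec_window Q (upd (upd rho 13 l2) 14 (rev l1)) (p + size l1) (q + size l1)
      (phi ++ windows Q (size l1) p q) B ltac:(lia) ltac:(lia) ltac:(lia) ltac:(lia)
      ltac:(rewrite size_cat size_windows; lia)) (spec_Push 14 b _).
  have -> : (if b then Seq (window Q) (Push 14 true) else Seq (window Q) (Push 14 false))
    = Seq (window Q) (Push 14 b) by case: (b).
  apply: spec_eq sw _ _; last by rewrite /window_cost; lia.
  rewrite upd_cst // cst_ge // upd_upd upd_eq rev_rcons size_rcons !addnS; congr cst.
  by rewrite -addn1 windows_cat catA.
rewrite -S0; apply: spec_eq (spec_Seq s1 (spec_pour _ _)) _ _ => //.
  rewrite /St upd_cst // upd_cst // !cst_ge // !upd_eq; congr cst.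
  rewrite [in LHS](upd_ne _ _ (isT : 13 != 14)) upd_eq cats0 revK.
  by store_eq.
rewrite /St cst_ge // upd_eq size_rev.
move: (size l) (window_cost Q) => n w; rewrite !mulnS !mulnDr !mulSn; nia.
Qed.

End Cells.

(** * Well-formedness of the printing programs *)

Section Wf.
Variable K : nat.
Hypothesis K10 : 10 < K.

Lemma wf_Seq a b : cmd_wf K (Seq a b) = cmd_wf K a && cmd_wf K b.
Proof. by []. Qed.

Lemma mods_Seq i a b : mods i (Seq a b) = mods i a || mods i b.
Proof. by []. Qed.

Lemma wf_emit_tokens dst ks : 7 < dst \/ dst = 1 -> dst < K -> all token_ok ks ->
  cmd_wf K (emit_tokens dst ks).
Proof.
move=> d7 dK; elim: ks => //= -[n|j r] ks IH /andP[ok /IH wf]; rewrite /= wf andbT.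
  exact: wf_pushes.
case/andP: ok => j4 r8.
have := @wf_print K (4 + j) dst ltac:(lia) dK ltac:(lia) ltac:(lia) ltac:(lia) ltac:(lia).
by rewrite /= dK => ->.
Qed.

Lemma mods_emit_tokens i dst ks : 10 < i -> dst != i -> all token_ok ks ->
  mods i (emit_tokens dst ks) = false.
Proof.
move=> i10 di; elim: ks => //= -[n|j r] ks IH /andP[ok /IH wf]; rewrite /= wf orbF.
  exact: mods_pushes.
case/andP: ok => j4 r8.
have := @mods_print i (4 + j) dst ltac:(lia) ltac:(lia) ltac:(lia).
by rewrite /= (negbTE di) => ->.
Qed.

Lemma wf_emit_tpl ls : all schema_ok ls -> cmd_wf K (emit_tpl ls).
Proof.
elim: ls => //= l ls IH /andP[ok /IH ->]; rewrite andbT.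
rewrite wf_emit_tokens ?schema_tokens_ok //; [|by left|lia].
by have := @wf_incr K 8 ltac:(lia) isT.
Qed.

Lemma mods_emit_tpl i ls : 10 < i -> all schema_ok ls -> mods i (emit_tpl ls) = false.
Proof.
move=> i10; elim: ls => //= l ls IH /andP[ok /IH ->]; rewrite orbF.
rewrite mods_emit_tokens ?schema_tokens_ok //=; [|lia].
by have := @mods_incr i 8 ltac:(lia) ltac:(lia) ltac:(lia).
Qed.

Variable A : finType.
Implicit Types (P : pred A) (Q : pred (quad A)).

Let wf_ctr j : 3 < j -> j < 8 -> cmd_wf K (incr j).
Proof. by move=> *; apply: wf_incr; lia. Qed.

Let mods_ctr i j : 10 < i -> j < 8 -> mods i (incr j) = false.
Proof. by move=> *; apply: mods_incr; lia. Qed.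

Lemma wf_cell P : cmd_wf K (cell P).
Proof. by rewrite /cell wf_Seq wf_emit_tpl // wf_Seq wf_ctr. Qed.

Lemma mods_cell i P : 10 < i -> mods i (cell P) = false.
Proof. by move=> i10; rewrite /cell mods_Seq mods_emit_tpl // mods_Seq mods_ctr //=; lia. Qed.

Lemma wf_window Q : cmd_wf K (window Q).
Proof.
rewrite /window wf_Seq wf_emit_tpl // wf_Seq wf_ctr // wf_Seq wf_ctr //.
by rewrite wf_Seq wf_ctr // wf_Seq wf_ctr.
Qed.

Lemma mods_window i Q : 10 < i -> mods i (window Q) = false.
Proof.
move=> i10; rewrite /window mods_Seq mods_emit_tpl // mods_Seq mods_ctr // mods_Seq mods_ctr //.
by rewrite mods_Seq mods_ctr // mods_Seq mods_ctr //=; lia.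
Qed.

End Wf.

Lemma spec_windows (A : finType) (Q : pred (quad A)) rho p q phi B m n :
  size (rho 12) = m -> size (rho 13) = n -> rho 14 = [::] ->
  0 < p -> p.+1 < q -> q + m * n <= B -> size phi + 18 <= 18 * q ->
  spec (Loop 12 (window_block Q) (window_block Q)) (cst rho p q phi)
    (cst (upd rho 12 [::]) (p + m * n) (q + m * n) (phi ++ windows Q (m * n) p q))
    (m * (n.+1 * (window_cost Q + 6) * B.+1).+1 + 1).
Proof.
move=> <- <-; set l := rho 12; set n' := size (rho 13) => r14 p0 pq qB phiq.
pose St (l1 l2 : seq bool) := cst (upd rho 12 l2)
  (p + size l1 * n') (q + size l1 * n') (phi ++ windows Q (size l1 * n') p q).
have S0 : St [::] l = cst rho p q phi by rewrite /St /= !addn0 cats0 /l upd_id.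
have S1 : St l [::] = cst (upd rho 12 [::]) (p + size l * n') (q + size l * n')
   (phi ++ windows Q (size l * n') p q) by [].
rewrite -S0 -S1; apply: spec_Loop; first by rewrite /St cst_ge.
move=> l1 b l2 E; have szl : (size l1).+1 <= size l by rewrite E size_cat /=; lia.
have szn : size l1 * n' + n' <= size l * n'.
  by rewrite addnC -mulSn leq_mul2r szl orbT.
rewrite /St upd_cst // upd_upd (_ : (if b then _ else _) = window_block Q); last by case: (b).
have := @spec_window_block A Q (upd rho 12 l2) (p + size l1 * n') (q + size l1 * n')
  (phi ++ windows Q (size l1 * n') p q) B.
rewrite (_ : upd rho 12 l2 13 = rho 13) // -/n' => sw.
apply: spec_eq (sw r14 _ _ _ _) _ _; try lia.
  by rewrite size_cat size_windows; lia.
rewrite size_rcons -!addnA -mulSnr; congr cst.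
by rewrite [in RHS]mulSnr windows_cat catA.
Qed.

(** * Unary arithmetic on stacks *)

Definition pour_mul (j k m : nat) : cmd :=
  Loop j (pushes k (nseq m true)) (pushes k (nseq m true)).

Lemma rev_nseq (T : Type) n (x : T) : rev (nseq n x) = nseq n x.
Proof. by elim: n => // n IH; rewrite -{1}addn1 nseqD rev_cat IH. Qed.

Lemma spec_pour_mul j k m s : j != k ->
  spec (pour_mul j k m) s (upd (upd s j [::]) k (nseq (size (s j) * m) true ++ s k))
    (size (s j) * (2 * m).+2 + 1).
Proof.
move=> jk.
pose St (l1 l2 : seq bool) := upd (upd s j l2) k (nseq (size l1 * m) true ++ s k).
have S0 : St [::] (s j) = s by rewrite /St upd_id -[RHS](upd_id s k).
rewrite -{1}S0 -/(St (s j) [::]).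
apply: spec_eq (@spec_Loop j _ _ St (s j) (2 * m + 1) _ _) _ _ => //.
- by rewrite /St upd_ne // upd_eq.
- move=> l1 b l2 _; rewrite (_ : (if b then _ else _) = pushes k (nseq m true)); last by case: b.
  apply: spec_eq (spec_pushes _ _ _) _ _; last by rewrite size_nseq.
  rewrite rev_nseq /St size_rcons mulSn nseqD.
  by move/eqP: jk => jk; store_eq; rewrite catA.
- by lia.
Qed.

Definition dup (t j k : nat) : cmd :=
  Seq (pour_mul j t 1)
      (Loop t (Seq (Push j true) (Push k true)) (Seq (Push j true) (Push k true))).

Lemma spec_dup t j k n s : j != t -> k != t -> j != k -> s j = nseq n true -> s t = [::] ->
  spec (dup t j k) s (upd s k (nseq n true ++ s k)) (8 * n + 5).
Proof.
move=> jt kt jk sj st.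
pose St (l1 l2 : seq bool) := upd (upd (upd s t l2) j (nseq (size l1) true))
   k (nseq (size l1) true ++ s k).
move/eqP: (jt) (kt) (jk) => jt' /eqP kt' /eqP jk'.
have h1 := spec_pour_mul 1 s jt; rewrite sj size_nseq muln1 st cats0 in h1.
have h2 : spec (Loop t (Seq (Push j true) (Push k true)) (Seq (Push j true) (Push k true)))
   (St [::] (nseq n true)) (St (nseq n true) [::]) (size (nseq n true) * 3.+1 + 1).
  apply: spec_Loop; first by rewrite /St; upd_cases.
  move=> l1 b l2 _; rewrite (_ : (if b then _ else _) = Seq (Push j true) (Push k true)); last by case: b.
  apply: spec_eq (spec_Seq (spec_Push _ _ _) (spec_Push _ _ _)) _ _ => //.
  by rewrite /St size_rcons; store_eq.
have e : St [::] (nseq n true) = upd (upd s j [::]) t (nseq n true) by rewrite /St; store_eq.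
rewrite e size_nseq in h2; apply: spec_eq (spec_Seq h1 h2) _ _; last by lia.
by clear e h2; rewrite /St size_nseq; store_eq.
Qed.

Definition mul (t z x y : nat) : cmd :=
  Seq (Loop y (dup t x z) (dup t x z)) (pour_mul z y 1).

Lemma spec_mul t z x y a b s : uniq [:: t; z; x; y] ->
  s x = nseq a true -> s y = nseq b true -> s z = [::] -> s t = [::] ->
  spec (mul t z x y) s (upd s y (nseq (b * a) true)) (b * (8 * a + 6) + b * a * 4 + 3).
Proof.
rewrite /= !inE !negb_or !andbT => /and3P[/and3P[tz tx ty] /andP[zx zy] xy] sx sy sz st.
move/eqP: (tz) (tx) (ty) (zx) (zy) (xy) => tz' /eqP tx' /eqP ty' /eqP zx' /eqP zy' /eqP xy'.
pose St (l1 l2 : seq bool) := upd (upd s y l2) z (nseq (size l1 * a) true).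
have h1 : spec (Loop y (dup t x z) (dup t x z)) (St [::] (nseq b true)) (St (nseq b true) [::])
   (size (nseq b true) * (8 * a + 5).+1 + 1).
  apply: spec_Loop; first by rewrite /St; upd_cases.
  move=> l1 c l2 _; rewrite (_ : (if c then _ else _) = dup t x z); last by case: c.
  apply: spec_eq (@spec_dup t x z a _ _ _ _ _ _) _ _ => //; rewrite 1?eq_sym //.
  - by rewrite /St; upd_cases.
  - by rewrite /St; upd_cases.
  - by rewrite /St size_rcons mulSn nseqD; store_eq.
have e : St [::] (nseq b true) = s by rewrite /St /= -sy upd_id -sz upd_id.
have h2 := spec_pour_mul 1 (St (nseq b true) [::]) zy.
rewrite e size_nseq in h1; apply: spec_eq (spec_Seq h1 h2) _ _.
  by clear e h1 h2; rewrite /St !size_nseq muln1; store_eq; rewrite ?cats0 ?size_nseq //.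
by rewrite /St upd_eq !size_nseq; lia.
Qed.

Fixpoint pow (t z x y c : nat) : cmd :=
  if c is c'.+1 then Seq (pow t z x y c') (mul t z x y) else Push y true.

Lemma spec_pow t z x y c : uniq [:: t; z; x; y] -> exists2 g, poly_bounded g &
  forall a s, s x = nseq a true -> s y = [::] -> s z = [::] -> s t = [::] ->
  spec (pow t z x y c) s (upd s y (nseq (a ^ c) true)) (g a).
Proof.
move=> un; elim: c => [|c [g gp IH]].
  exists (fun=> 1); first exact: poly_bounded_const.
  by move=> a s sx sy sz st; apply: spec_eq (spec_Push _ _ _) _ _ => //; rewrite sy.
have ida := poly_bounded_id.
exists (fun a => (g a + (a ^ c * (8 * a + 6) + a ^ c * a * 4 + 3)).+1).
  have ac := poly_bounded_exp c ida.
  have k := poly_bounded_const.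
  have h1 := poly_bounded_mul ac (poly_bounded_add (poly_bounded_mul (k 8) ida) (k 6)).
  have h2 := poly_bounded_mul (poly_bounded_mul ac ida) (k 4).
  have := poly_bounded_add (k 1) (poly_bounded_add gp (poly_bounded_add (poly_bounded_add h1 h2) (k 3))).
  by apply: poly_bounded_le => n; rewrite add1n.
move=> a s sx sy sz st.
move: (un); rewrite /= !inE !negb_or !andbT => /and3P[/and3P[tz tx ty] /andP[zx zy] xy].
apply: spec_eq (spec_Seq (IH a s sx sy sz st) (@spec_mul t z x y a (a ^ c) _ un _ _ _ _)) _ (leqnn _);
  rewrite ?upd_eq ?upd_ne //.
by rewrite upd_upd expnSr.
Qed.

Definition poly (t z x y d c : nat) : cmd :=
  Seq (pow t z x y c) (Seq (pour_mul y d c) (pushes d (nseq c true))).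

Lemma spec_poly t z x y d c : uniq [:: t; z; x; y; d] -> exists2 g, poly_bounded g &
  forall a s, s x = nseq a true -> s y = [::] -> s z = [::] -> s t = [::] -> s d = [::] ->
  spec (poly t z x y d c) s (upd s d (nseq (c * a ^ c + c) true)) (g a).
Proof.
move=> un; have [|g gp h] := @spec_pow t z x y c.
  by move: un; rewrite (cat_uniq [:: t; z; x; y] [:: d]) => /andP[].
exists (fun a => (g a + (a ^ c * (2 * c).+2 + 1 + (2 * c + 1)).+1).+1).
  have k := poly_bounded_const; have ac := poly_bounded_exp c poly_bounded_id.
  have := poly_bounded_add (k (2 * c + 4)) (poly_bounded_add gp (poly_bounded_mul ac (k (2 * c).+2))).
  by apply: poly_bounded_le => n; lia.
move=> a s sx sy sz st sd.
have yd : y != d by move: un; rewrite /= !inE !negb_or => /and5P[].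
apply: spec_eq (spec_Seq (h a s sx sy sz st) (spec_Seq (spec_pour_mul c _ yd) (spec_pushes _ _ _))) _ _.
  rewrite !upd_eq rev_nseq size_nseq !upd_upd upd_ne 1?eq_sym // sd cats0 -nseqD.
  rewrite addnC mulnC; move/eqP: yd => yd; store_eq.
by rewrite upd_eq !size_nseq.
Qed.

(** * The reduction as a stack program *)

Definition poly_val (c n : nat) : nat := c * n ^ c + c.

Lemma poly_bounded_poly_val c g : poly_bounded g -> poly_bounded (fun n => poly_val c (g n)).
Proof.
move=> gp; have k := poly_bounded_const.
exact: poly_bounded_add (poly_bounded_mul (k c) (poly_bounded_exp c gp)) (k c).
Qed.

Section Program.
Variables (A : finType) (Q : pred (quad A)) (KB KS KG : pred A) (Kb : bool -> pred A).
Variables (c d : nat).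

(** The parameters [c] and [d] are those of the polynomials bounding the witness and the running
    time of the verifier; [input_len] bounds the length of [pair_enc w y]. *)
Definition guess_len (n : nat) : nat := poly_val c n.
Definition input_len (n : nat) : nat := 2 * n + 2 + guess_len n.
Definition run_len (n : nat) : nat := poly_val d (input_len n).

(** The doubled bits of [w], the pair 01 and the guessed region spell [pair_enc w y]. The padding by
    [run_len] on both sides keeps the head away from the ends of the row. *)
Definition first_row_kinds (w : seq bool) : seq (pred A) :=
  nseq (run_len (size w)) KB ++ [:: KB; KB; KS] ++
  flatten [seq [:: Kb b; Kb b] | b <- w] ++ [:: Kb false; Kb true] ++
  nseq (guess_len (size w)) KG ++ nseq (run_len (size w)) KB ++ [:: KB; KB; KB].

(* Stack 15 receives the input in reading order, stack 16 its length in unary. *)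
Definition read_cmd : cmd :=
  Loop 0 (Seq (Push 15 false) (Push 16 true)) (Seq (Push 15 true) (Push 16 true)).

Definition counters_cmd : cmd :=
  Seq (pushes 4 [:: true]) (Seq (pushes 5 [:: true; false]) (Seq (pushes 6 [:: true; true])
    (Seq (pushes 7 [:: true]) (pushes 10 [:: true])))).

Definition lengths_cmd : cmd :=
  Seq (poly 19 18 16 17 20 c) (Seq (pour_mul 16 21 2) (Seq (pushes 21 [:: true; true])
    (Seq (dup 19 20 21) (Seq (poly 19 18 21 17 22 d) (dup 19 22 23))))).

Definition cells_cmd : cmd :=
  let cells3 K1 K2 K3 := Seq (cell K1) (Seq (cell K2) (cell K3)) in
  Seq (Loop 22 (cell KB) (cell KB)) (Seq (cells3 KB KB KS)
  (Seq (Loop 15 (Seq (cell (Kb false)) (cell (Kb false)))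
                (Seq (cell (Kb true)) (cell (Kb true))))
  (Seq (Seq (cell (Kb false)) (cell (Kb true)))
  (Seq (Loop 20 (cell KG) (cell KG))
  (Seq (Loop 23 (cell KB) (cell KB)) (cells3 KB KB KB)))))).

(** At this point stack 10 holds [q], one more than the length of the first row, so [q * q] windows
    take two copies and nested loops. Surplus rows are harmless, as a halted configuration repeats
    itself. *)
Definition windows_cmd : cmd :=
  Seq (dup 19 10 12) (Seq (dup 19 10 13) (Loop 12 (window_block Q) (window_block Q))).

(** Pouring stack 9 twice preserves its order. The number of bounds is [8 * q], which is the index
    of the variable with counter 3 and tag 0, so it is printed as such. *)
Definition output_cmd : cmd :=
  Seq (pushes 1 (enc_nat (sep A).+1)) (Seq (print 8 1) (Seq (pushes 1 [:: false; true])
  (Seq (pour 9 2) (Seq (pour 2 1) (Seq (emit_token 1 (TVar 3 0))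
    (Loop 10 (pushes 1 (enc_nats bound_block)) (pushes 1 (enc_nats bound_block)))))))).

Definition build_cmd : cmd :=
  Seq read_cmd (Seq counters_cmd (Seq lengths_cmd (Seq cells_cmd windows_cmd))).

Definition rho_read (w : seq bool) : store :=
  fun i => match i with 15 => w | 16 => nseq (size w) true | _ => [::] end.

Definition rho_lengths (w : seq bool) : store := fun i =>
  match i with
  | 15 => w
  | 20 => nseq (guess_len (size w)) true
  | 21 => nseq (input_len (size w)) true
  | 22 | 23 => nseq (run_len (size w)) true
  | _ => [::]
  end.

Definition rho_cells (w : seq bool) : store := fun i =>
  if i == 21 then nseq (input_len (size w)) true else [::].

Lemma spec_read w : spec read_cmd (init_store w) (rho_read w) (size w * 4 + 1).
Proof.
pose St (l1 l2 : seq bool) : store := fun i =>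
  match i with 0 => l2 | 15 => rev l1 | 16 => nseq (size l1) true | _ => [::] end.
have e0 : St [::] (rev w) = init_store w.
  by apply: functional_extensionality => i; do 17?[case: i => [|i] //].
have e1 : St (rev w) [::] = rho_read w.
  apply: functional_extensionality => i; do 17?[case: i => [|i] //]; rewrite /St /=.
    by rewrite revK.
  by rewrite size_rev.
rewrite -e0 -e1 -(size_rev w); apply: spec_Loop => // l1 b l2 _.
have -> : (if b then Seq (Push 15 true) (Push 16 true) else Seq (Push 15 false) (Push 16 true))
   = Seq (Push 15 b) (Push 16 true) by case: b.
apply: spec_eq (spec_Seq (spec_Push _ _ _) (spec_Push _ _ _)) _ _ => //.
apply: functional_extensionality => i; do 17?[case: i => [|i] //]; rewrite /St /upd /=.
  by rewrite rev_rcons.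
by rewrite size_rcons.
Qed.

Lemma spec_counters w : spec counters_cmd (rho_read w) (cst (rho_read w) 1 1 [::]) 25.
Proof.
apply: spec_eq (spec_Seq (spec_pushes _ _ _) (spec_Seq (spec_pushes _ _ _)
  (spec_Seq (spec_pushes _ _ _) (spec_Seq (spec_pushes _ _ _) (spec_pushes _ _ _))))) _ _ => //.
by apply: functional_extensionality => i; do 11?[case: i => [|i] //].
Qed.

Lemma spec_lengths : exists2 g, poly_bounded g & forall w,
  spec lengths_cmd (cst (rho_read w) 1 1 [::]) (cst (rho_lengths w) 1 1 [::]) (g (size w)).
Proof.
have [//|g1 gp1 h1] := @spec_poly 19 18 16 17 20 c.
have [//|g2 gp2 h2] := @spec_poly 19 18 21 17 22 d.
(* The cost of the second polynomial is taken at [input_len n]; an explicit exponent turns it into a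
   polynomial in [n]. *)
have [e2 e2P] := gp2.
have k := poly_bounded_const; have ip := poly_bounded_id.
have gl : poly_bounded guess_len := poly_bounded_poly_val c ip.
have il : poly_bounded input_len :=
  poly_bounded_add (poly_bounded_add (poly_bounded_mul (k 2) ip) (k 2)) gl.
have rl : poly_bounded run_len := poly_bounded_poly_val d il.
exists (fun n => (g1 n + (n * 6 + 1 + (2 * 2 + 1 + (8 * guess_len n + 5 +
   ((input_len n + 2) ^ e2 + (8 * run_len n + 5)).+1).+1).+1).+1).+1).
  have p1 := poly_bounded_add gp1 (poly_bounded_mul ip (k 6)).
  have p2 := poly_bounded_add (poly_bounded_mul (k 8) gl) (poly_bounded_mul (k 8) rl).
  have p3 := poly_bounded_exp e2 (poly_bounded_add il (k 2)).
  have := poly_bounded_add (poly_bounded_add p1 p2) (poly_bounded_add p3 (k 100)).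
  by apply: poly_bounded_le => n; lia.
move=> w; set n := size w; set s0 := cst _ _ _ _.
have q1 := h1 n s0 erefl erefl erefl erefl erefl.
have q2 := spec_pour_mul 2 (upd s0 20 (nseq (guess_len n) true)) (isT : 16 != 21).
set s2 := upd _ 21 _ in q2.
have q3 := spec_pushes 21 [:: true; true] s2; set s3 := upd _ _ _ in q3.
have q4 := @spec_dup 19 20 21 (guess_len n) s3 isT isT isT erefl erefl.
set s4 := upd s3 _ _ in q4.
have e4 : s4 21 = nseq (input_len n) true.
  rewrite /s4 /s3 /s2 /upd /= size_nseq cats0 -[[:: true, true & _]]/(nseq (2 + n * 2) true) -nseqD.
  by rewrite /input_len; congr nseq; lia.
have q5 := h2 (input_len n) s4 e4 erefl erefl erefl erefl.
set s5 := upd s4 _ _ in q5.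
have q6 := @spec_dup 19 22 23 (run_len n) s5 isT isT isT erefl erefl.
apply: spec_eq (spec_Seq q1 (spec_Seq q2 (spec_Seq q3 (spec_Seq q4 (spec_Seq q5 q6))))) _ _.
  apply: functional_extensionality => i; do 24?[case: i => [|i] //].
  by rewrite /upd /= cats0.
rewrite -[size (upd _ _ _ _)]/(size (nseq n true)) size_nseq.
by have := e2P (input_len n); rewrite addn2 [size [:: _; _]]/=; lia.
Qed.

Lemma flatten_nseq1 (T : Type) n (x : T) (l : seq bool) : size l = n ->
  flatten [seq if b then [:: x] else [:: x] | b <- l] = nseq n x.
Proof. by move=> <-; elim: l => //= b l ->; case: b. Qed.

Lemma emits_nseq j (K : pred A) rho n : 10 < j -> rho j = nseq n true ->
  emits (Loop j (cell K) (cell K)) rho (upd rho j [::]) (nseq n K)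
    (n * (tpl_cost (cell_tpl K) + 25).+1 + 1).
Proof.
move=> j10 rj; have := emits_Loop (@emits_cell A K) (@emits_cell A K) j10.
by move=> /(_ rho); rewrite rj (flatten_nseq1 K (size_nseq n true)) size_nseq.
Qed.

Lemma spec_cells : exists2 g, poly_bounded g & forall w,
  emits cells_cmd (rho_lengths w) (rho_cells w) (first_row_kinds w) (g (size w)).
Proof.
have k := poly_bounded_const; have ip := poly_bounded_id.
have gl : poly_bounded guess_len := poly_bounded_poly_val c ip.
have il : poly_bounded input_len :=
  poly_bounded_add (poly_bounded_add (poly_bounded_mul (k 2) ip) (k 2)) gl.
have rl : poly_bounded run_len := poly_bounded_poly_val d il.
pose C (K : pred A) := tpl_cost (cell_tpl K) + 25.
pose M := (C KB + C KS + C KG + 2 * C (Kb false) + 2 * C (Kb true) + 10).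
exists (fun n => M.+1 * (2 * run_len n + n + guess_len n + 20)).
  have p1 := poly_bounded_add (poly_bounded_add (poly_bounded_mul (k 2) rl) ip) gl.
  exact: poly_bounded_mul (k M.+1) (poly_bounded_add p1 (k 20)).
move=> w; set rho0 := rho_lengths w; set n := size w.
pose rho1 := upd rho0 22 [::]; pose rho2 := upd rho1 15 [::].
pose rho3 := upd rho2 20 [::]; pose rho4 := upd rho3 23 [::].
have c3 rho K1 K2 K3 : emits (Seq (cell K1) (Seq (cell K2) (cell K3))) rho rho [:: K1; K2; K3]
    (C K1 + (C K2 + C K3).+1).+1.
  exact: emits_Seq (@emits_cell A K1 rho) (emits_Seq (@emits_cell A K2 rho) (@emits_cell A K3 rho)).
have c2 rho K1 K2 : emits (Seq (cell K1) (cell K2)) rho rho [:: K1; K2] (C K1 + C K2).+1.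
  exact: emits_Seq (@emits_cell A K1 rho) (@emits_cell A K2 rho).
have le_emits a rho rho' ks k1 k2 : k1 <= k2 -> emits a rho rho' ks k1 ->
    emits (A := A) a rho rho' ks k2.
  move=> kk h q phi B q0 B3 qB phiq; apply: spec_eq (h q phi B q0 B3 qB phiq) _ _ => //.
  by rewrite leq_mul2r kk orbT.
have e1 := @emits_nseq 22 KB rho0 (run_len n) isT erefl.
have kb b rho : emits (Seq (cell (Kb b)) (cell (Kb b))) rho rho [:: Kb b; Kb b] M.
  by apply: le_emits (c2 rho (Kb b) (Kb b)); rewrite /M; case: b; lia.
have e2 := emits_Loop (kb false) (kb true) (isT : 10 < 15) (rho := rho1).
have e3 := @emits_nseq 20 KG rho2 (guess_len n) isT erefl.
have e4 := @emits_nseq 23 KB rho3 (run_len n) isT erefl.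
have -> : rho_cells w = rho4.
  by apply: functional_extensionality => i; do 24?[case: i => [|i] //].
have := emits_Seq e1 (emits_Seq (c3 rho1 KB KB KS) (emits_Seq e2
  (emits_Seq (c2 rho2 (Kb false) (Kb true)) (emits_Seq e3 (emits_Seq e4 (c3 rho4 KB KB KB)))))).
rewrite -[rho1 15]/w (_ : flatten [seq if b then _ else _ | b <- w] =
  flatten [seq [:: Kb b; Kb b] | b <- w]); last first.
  by congr flatten; apply: eq_map => -[].
apply: le_emits; rewrite -/(C KB) -/(C KG) -/n.
have t1 : run_len n * (C KB).+1 <= run_len n * M.+1 by rewrite leq_mul2l /M; lia.
have t2 : guess_len n * (C KG).+1 <= guess_len n * M.+1 by rewrite leq_mul2l /M; lia.
have t3 : C KB + C KS + C KG + C (Kb false) + C (Kb true) + 10 <= M by rewrite /M; lia.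
lia.
Qed.

Lemma size_first_row_kinds w :
  size (first_row_kinds w) = 2 * run_len (size w) + 2 * size w + guess_len (size w) + 8.
Proof.
rewrite /first_row_kinds !size_cat !size_nseq /= (_ : size (flatten _) = 2 * size w); first by lia.
by elim: w => //= b w ->; lia.
Qed.

Lemma spec_build : exists2 g, poly_bounded g & forall w,
  let q := (size (first_row_kinds w)).+1 in
  exists2 rho, rho 1 = [::] &
    spec build_cmd (init_store w) (cst rho (1 + q * q) (q + q * q)
       (cells (first_row_kinds w) 1 ++ windows Q (q * q) 1 q)) (g (size w)).
Proof.
have k := poly_bounded_const; have ip := poly_bounded_id.
have gl : poly_bounded guess_len := poly_bounded_poly_val c ip.
have il : poly_bounded input_len :=
  poly_bounded_add (poly_bounded_add (poly_bounded_mul (k 2) ip) (k 2)) gl.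
have rl : poly_bounded run_len := poly_bounded_poly_val d il.
have [g1 gp1 h1] := spec_lengths; have [g2 gp2 h2] := spec_cells.
pose qf n := 2 * run_len n + 2 * n + guess_len n + 9.
have qp : poly_bounded qf := poly_bounded_add (poly_bounded_add (poly_bounded_add
  (poly_bounded_mul (k 2) rl) (poly_bounded_mul (k 2) ip)) gl) (k 9).
pose Bf n := (qf n + qf n * qf n) + 1.
have Bp : poly_bounded Bf :=
  poly_bounded_add (poly_bounded_add qp (poly_bounded_mul qp qp)) (k 1).
pose wf n := qf n * ((qf n + 1) * (window_cost Q + 6) * Bf n + 1) + 1.
have wp : poly_bounded wf := poly_bounded_add (poly_bounded_mul qp (poly_bounded_add
  (poly_bounded_mul (poly_bounded_mul (poly_bounded_add qp (k 1)) (k (window_cost Q + 6))) Bp)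
  (k 1))) (k 1).
exists (fun n => n * 4 + g1 n + g2 n * Bf n + 16 * qf n + wf n + 100).
  have p1 := poly_bounded_add (poly_bounded_mul ip (k 4)) gp1.
  have p2 := poly_bounded_add p1 (poly_bounded_mul gp2 Bp).
  have p3 := poly_bounded_add p2 (poly_bounded_mul (k 16) qp).
  exact: poly_bounded_add (poly_bounded_add p3 wp) (k 100).
move=> w q; set n := size w; pose B := q + q * q.
have qE : q = qf n by rewrite /q size_first_row_kinds -/n /qf; lia.
have q9 : 9 <= q by rewrite qE /qf; lia.
have s1 := h2 w 1 [::] B isT ltac:(lia) ltac:(rewrite add1n -/q; lia) isT.
set s := cst (rho_cells w) _ _ _ in s1.
have sE : s = cst (rho_cells w) 1 q (cells (first_row_kinds w) 1) by rewrite /s add1n.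
have s10 : s 10 = nseq q true by rewrite sE.
have s2 := @spec_dup 19 10 12 q s isT isT isT s10 erefl; set t := upd s 12 _ in s2.
have s3 := @spec_dup 19 10 13 q t isT isT isT s10 erefl; set u := upd t 13 _ in s3.
pose rho := upd (upd (rho_cells w) 12 (nseq q true)) 13 (nseq q true).
have uE : u = cst rho 1 q (cells (first_row_kinds w) 1).
  rewrite /u /t -[s 12]/[::] -[upd s 12 _ 13]/[::] !cats0 sE.
  by rewrite upd_cst // upd_cst.
have r12 : size (rho 12) = q by rewrite /rho /upd /= size_nseq.
have r13 : size (rho 13) = q by rewrite /rho /upd /= size_nseq.
have phiq : size (cells (first_row_kinds w) 1) + 18 <= 18 * q by rewrite size_cells /q; lia.
have s4 := @spec_windows A Q rho 1 q (cells (first_row_kinds w) 1) B q q r12 r13 erefl isT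
  ltac:(lia) (leqnn _) phiq.
rewrite -uE in s4.
exists (upd rho 12 [::]) => //.
apply: spec_eq (spec_Seq (spec_read w) (spec_Seq (spec_counters w) (spec_Seq (h1 w)
  (spec_Seq s1 (spec_Seq s2 (spec_Seq s3 s4)))))) _ _ => //.
rewrite -/n -qE /wf /Bf -qE !addn1; lia.
Qed.

Lemma spec_output rho p q phi B : rho 1 = [::] -> 0 < p -> 0 < q -> p.+2 <= B -> q <= B ->
  size phi <= 18 * B ->
  exists2 s', rev (s' 1) = enc_nat (sep A).+1 ++ enc_nat (size phi) ++ ser_formula phi ++
      enc_nat (8 * q) ++ flatten (nseq q (enc_nats bound_block)) &
    spec output_cmd (cst rho p q phi) s'
      (2 * size (enc_nat (sep A).+1) + 4 * size (ser_formula phi)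
        + (300 + 2 * size (enc_nats bound_block)) * B.+1).
Proof.
move=> r1 p0 q0 pB qB phiB; set blk := enc_nats bound_block.
set s0 := cst rho p q phi.
have q1 := spec_pushes 1 (enc_nat (sep A).+1) s0; set s1 := upd s0 _ _ in q1.
have q2 := @spec_print 8 1 s1 isT isT isT erefl; set s2 := upd s1 _ _ in q2.
have q3 := spec_pushes 1 [:: false; true] s2; set s3 := upd s2 _ _ in q3.
have q4 := spec_pour s3 (isT : 9 != 2); set s4 := upd _ 2 _ in q4.
have q5 := spec_pour s4 (isT : 2 != 1); set s5 := upd _ 1 _ in q5.
have cs : counters (env p q) s5.
  by move=> j j4; have := counters_cst rho phi p0 q0 j4; case: j j4 => [|[|[|[|]]]].
have eB j : j < 4 -> env p q j <= B by rewrite /env; case: j => [|[|[|[|]]]] //= _; lia.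
have q6 := spec_emit_token (k := TVar 3 0) cs erefl (or_intror erefl) eB isT.
set s6 := upd s5 _ _ in q6.
pose St (l1 l2 : seq bool) := upd (upd s6 10 l2) 1 (rev (flatten (nseq (size l1) blk)) ++ s6 1).
have q7 : spec (Loop 10 (pushes 1 blk) (pushes 1 blk))
    (St [::] (nseq q true)) (St (nseq q true) [::]) (size (nseq q true) * (2 * size blk + 1).+1 + 1).
  apply: spec_Loop => // l1 b l2 _.
  rewrite (_ : (if b then _ else _) = pushes 1 blk); last by case: b.
  apply: spec_eq (spec_pushes _ _ _) _ _ => //.
  have E : flatten (nseq (size l1).+1 blk) = flatten (nseq (size l1) blk) ++ blk.
    by rewrite -[(size l1).+1]addn1 nseqD flatten_cat; congr (_ ++ _); apply: cats0.
  rewrite /St size_rcons E rev_cat {E}.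
  by clear; store_eq; rewrite catA.
have e6 : St [::] (nseq q true) = s6.
  by rewrite /St -[RHS](upd_id s6 1) -[X in _ = upd X _ _](upd_id s6 10).
rewrite e6 size_nseq in q7.
exists (St (nseq q true) [::]).
  rewrite /St upd_eq size_nseq rev_cat revK.
  rewrite /s6 upd_eq rev_cat revK /s5 upd_eq rev_cat revK.
  have -> : s4 1 = s3 1 by [].
  have -> : s4 2 = ser_formula phi by rewrite /s4 upd_eq -[s3 9]/(rev (ser_formula phi)) revK cats0.
  rewrite /s3 upd_eq rev_cat revK /s2 upd_eq rev_cat revK /s1 upd_eq rev_cat revK.
  by rewrite -[s0 1]/(rho 1) r1 /= /vix addn0 -!catA.
apply: spec_eq (spec_Seq q1 (spec_Seq q2 (spec_Seq q3 (spec_Seq q4 (spec_Seq q5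
  (spec_Seq q6 q7)))))) erefl _.
have z1 : size (s1 8) <= 18 * B by apply: size_bits_le.
have z2 : size (s3 9) = size (ser_formula phi) by rewrite -[s3 9]/(rev (ser_formula phi)) size_rev.
have z3 : size (s4 2) = size (ser_formula phi) by rewrite /s4 upd_eq size_cat size_rev z2 addn0.
rewrite z2 z3 [token_cost _]/= [size [:: _; _]]/= mulnDl.
have : q * (2 * size blk + 1).+1 <= B.+1 * (2 * size blk + 1).+1 by rewrite leq_mul2r; lia.
rewrite (_ : B.+1 * _ = 2 * size blk * B.+1 + 2 * B.+1); lia.
Qed.

Definition program : cmd := Seq build_cmd output_cmd.

Lemma wf_program : cmd_wf 24 program.
Proof.
have wS a b : cmd_wf 24 a -> cmd_wf 24 b -> cmd_wf 24 (Seq a b) by rewrite wf_Seq => -> ->.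
have wL j a b : j < 24 -> cmd_wf 24 a -> cmd_wf 24 b -> mods j a = false -> mods j b = false ->
    cmd_wf 24 (Loop j a b) by move=> /= -> -> -> -> ->.
have mS i a b : mods i a = false -> mods i b = false -> mods i (Seq a b) = false.
  by rewrite mods_Seq => -> ->.
have mL i j a b : j != i -> mods i a = false -> mods i b = false -> mods i (Loop j a b) = false.
  by move=> /= /negbTE-> -> ->.
have wpow t z x y n : uniq [:: t; z; x; y] -> all (fun i => i < 24) [:: t; z; x; y] ->
    cmd_wf 24 (pow t z x y n).
  rewrite /= !inE !negb_or !andbT => /and3P[/and3P[tz tx ty] /andP[zx zy] xy].
  case/and4P=> lt lz lx ly; elim: n => //= n ->.
  rewrite /mul /dup /pour_mul /=.
  by rewrite lt lz lx ly !(eq_sym _ y) !(eq_sym _ z) ?ty; lia.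
rewrite /program /build_cmd /read_cmd /counters_cmd /lengths_cmd /cells_cmd /windows_cmd
  /output_cmd /window_block /poly /dup /pour_mul /pour.
repeat match goal with
| |- is_true (cmd_wf _ (Seq _ _)) => apply wS
| |- is_true (cmd_wf _ (Loop _ _ _)) => apply wL
| |- is_true (cmd_wf _ (cell _)) => apply: wf_cell
| |- is_true (cmd_wf _ (window _)) => apply: wf_window
| |- is_true (cmd_wf _ (pushes _ _)) => apply: wf_pushes
| |- is_true (cmd_wf _ (pow _ _ _ _ _)) => apply wpow
| |- is_true (cmd_wf _ (print _ _)) => apply: wf_print
| |- mods _ (Seq _ _) = false => apply mS
| |- mods _ (Loop _ _ _) = false => apply mL
| |- mods _ (cell _) = false => apply: mods_cell
| |- mods _ (window _) = false => apply: mods_window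
| |- mods _ (pushes _ _) = false => apply: mods_pushes
| |- _ => by []
end.

Qed.

Definition tiling_instance_of (w : seq bool) : instance :=
  tiling_instance Q (first_row_kinds w) ((size (first_row_kinds w)).+1 * (size (first_row_kinds w)).+1).

Lemma enc_nats_cons n s : enc_nats (n :: s) = enc_nat n ++ enc_nats s.
Proof. by []. Qed.

Lemma enc_tiling_instance_of w (q := (size (first_row_kinds w)).+1)
    (phi := cells (first_row_kinds w) 1 ++ windows Q (q * q) 1 q) :
  enc_instance (tiling_instance_of w) = enc_nat (sep A).+1 ++ enc_nat (size phi) ++
    ser_formula phi ++ enc_nat (8 * (q + q * q)) ++
    flatten (nseq (q + q * q) (enc_nats bound_block)).
Proof.
pose bnd := flatten (nseq (q + q * q) bound_block).
rewrite -[LHS]/(enc_nats [:: (sep A).+1, size phi & flatten (map ser_bexp phi) ++ size bnd :: bnd]).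
rewrite (enc_nats_cons (sep A).+1) (enc_nats_cons (size phi)) enc_nats_cat.
rewrite (enc_nats_cons (size bnd)) /bnd size_bound_blocks -/(ser_formula phi).
congr (_ ++ (_ ++ (_ ++ (_ ++ _)))).
elim: (q + q * q) => // m IH.
by rewrite -[LHS]/(enc_nats (bound_block ++ flatten (nseq m bound_block))) enc_nats_cat IH.
Qed.

Theorem tiling_poly_time_computable :
  poly_time_computable (fun w => enc_instance (tiling_instance_of w)).
Proof.
have [g gp build] := spec_build.
pose qf n := 2 * run_len n + 2 * n + guess_len n + 9.
have qp : poly_bounded qf.
  have k := poly_bounded_const; have ip := poly_bounded_id.
  have gl : poly_bounded guess_len := poly_bounded_poly_val c ip.
  have il : poly_bounded input_len :=
    poly_bounded_add (poly_bounded_add (poly_bounded_mul (k 2) ip) (k 2)) gl.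
  have rl : poly_bounded run_len := poly_bounded_poly_val d il.
  exact: poly_bounded_add (poly_bounded_add (poly_bounded_add
    (poly_bounded_mul (k 2) rl) (poly_bounded_mul (k 2) ip)) gl) (k 9).
pose Bf n := qf n + qf n * qf n + 3.
pose k1 := 2 * size (enc_nat (sep A).+1); pose k2 := 300 + 2 * size (enc_nats bound_block).
pose G n := g n + (k1 + 4 * (n + g n) + k2 * (Bf n + 1)) + 1.
have Gp : poly_bounded G.
  have k := poly_bounded_const; have ip := poly_bounded_id.
  have Bp : poly_bounded Bf :=
    poly_bounded_add (poly_bounded_add qp (poly_bounded_mul qp qp)) (k 3).
  exact: poly_bounded_add (poly_bounded_add gp (poly_bounded_add (poly_bounded_add (k k1)
    (poly_bounded_mul (k 4) (poly_bounded_add ip gp)))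
    (poly_bounded_mul (k k2) (poly_bounded_add Bp (k 1))))) (k 1).
have all_spec w : exists2 s', rev (s' 1) = enc_instance (tiling_instance_of w) &
    spec program (init_store w) s' (G (size w)).
  have [rho r1 sb] := build w; set q := (size (first_row_kinds w)).+1 in sb.
  have qE : q = qf (size w) by rewrite /q size_first_row_kinds /qf; lia.
  set phi := cells _ _ ++ _ in sb.
  have phiB : size phi <= 18 * Bf (size w).
    by rewrite /phi size_cat size_cells size_windows /Bf -qE /q; lia.
  have [||||s' e so] := @spec_output rho (1 + q * q) (q + q * q) phi (Bf (size w)) r1 _ _ _ _ phiB.
  - by lia.
  - by rewrite /q; lia.
  - by rewrite /Bf -qE; lia.
  - by rewrite /Bf -qE; lia.
  exists s'; first by rewrite e enc_tiling_instance_of.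
  apply: spec_eq (spec_Seq sb so) erefl _.
  (* No estimate of the code is needed: the formula sits on stack 9, and building it cannot push
     more bits than it performs operations. *)
  have szF : size (ser_formula phi) <= size w + g (size w).
    have [h1 h2] := sb; rewrite -(size_rev (ser_formula phi)).
    rewrite -[rev _]/(cst rho (1 + q * q) (q + q * q) phi 9) -h1.
    apply: leq_trans (size_run build_cmd _ 9) (_ : size w + ops build_cmd (init_store w) <= _).
      by move=> j; rewrite /init_store; case: eqP => // _; rewrite size_rev.
    by rewrite leq_add2l.
  by rewrite /G /k1 /k2 addn1; lia.
apply: (@cmd_poly_time_computable 22 program _ G wf_program _ _ Gp) => w;
  by have [s' e [h1 h2]] := all_spec w; rewrite ?h1.
Qed.
End Program.

(** * Computation tableaux *)

Section Tableau.
Variable V : TM.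

(* [None] is a state added before the start state: it sits on the blank cell left of
   the input, so that the first row does not depend on the first input bit. *)
Definition xstate : Type := option (tm_state V).

Definition xhalt (q : xstate) : bool := if q is Some q' then tm_halt q' else false.
Definition xdelta (q : xstate) (g : tm_sym V) : xstate * tm_sym V * bool :=
  if q is Some q' then let: (q2, g', mv) := tm_delta q' g in (Some q2, g', mv)
  else (Some (tm_start V), g, true).
Definition xreject (q : xstate) : bool :=
  if q is Some q' then tm_halt q' && ~~ tm_accept q' else false.

Definition xconfig : Type := (xstate * nat * (nat -> tm_sym V))%type.

Definition xstep (a : xconfig) : xconfig :=
  let: (q, p, tp) := a in
  if xhalt q then a else
  let: (q', g, mv) := xdelta q (tp p) in (q', if mv then p.+1 else p.-1, upd tp p g).

Definition tcell : Type := (tm_sym V * option xstate)%type.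

Definition cell_at (a : xconfig) (i : nat) : tcell :=
  let: (q, p, tp) := a in (tp i, if i == p then Some q else None).

Definition moves_to (mv : bool) (x : tcell) : option xstate :=
  if x.2 is Some q then
    if ~~ xhalt q && ((xdelta q x.1).2 == mv) then Some (xdelta q x.1).1.1 else None
  else None.

(** Keeping a halted head in place makes the rows constant once the verifier stops, so the tableau
    may have more rows than the run has steps. *)
Definition next_cell (l x r : tcell) : tcell :=
  if x.2 is Some q then if xhalt q then x else ((xdelta q x.1).1.2, None)
  else (x.1, if moves_to true l is Some q then Some q else moves_to false r).

Lemma cell_at_step a i : cell_at (xstep a) i.+1 =
  next_cell (cell_at a i) (cell_at a i.+1) (cell_at a i.+2).
Proof.
case: a => [[q p] tp]; rewrite /cell_at /xstep /next_cell /moves_to /=.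
case hq: (xhalt q) => /=.
  case: eqP => [_|ne] /=; first by rewrite hq.
  by case: (i == p); case: (i.+2 == p); rewrite /= ?hq.
case E: (xdelta q (tp p)) => [[q' g] mv] /=; rewrite /upd.
case: (i.+1 =P p) => [e|ne] /=.
  by rewrite e hq E; case: (mv); case: eqP => //; lia.
congr pair; case: (i =P p) => [e|ne1] /=.
  rewrite e hq E /=; case: (mv) => /=; first by rewrite eqxx.
  by rewrite (_ : (p.+1 == p.-1) = false) 1?(_ : (p.+2 == p) = false) //; lia.
case: (i.+2 =P p) => [e|ne2] /=.
  by rewrite e hq E /=; case: (mv) => /=; case: eqP => //; lia.
by case: (mv); case: eqP => //; lia.
Qed.

Definition represents_tm (c : config V) (a : xconfig) : Prop :=
  let: (q, l, h, r) := c in let: (q', p, tp) := a in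
  q' = Some q /\ tape_at (tm_blank V) l h r p tp.

Lemma represents_tm_step c a : 0 < a.1.2 -> represents_tm c a ->
  represents_tm (tm_step c) (xstep a).
Proof.
case: c a => [[[q l] h] r] [[_ p] tp] /= p0 [-> tpr].
rewrite /represents_tm /xstep /tm_step /=; case: ifP => //= _.
have [-> _ _] := tpr; case: (tm_delta q h) => [[q' g] []] /=; split=> //.
  exact: tape_right tpr.
exact: tape_left tpr.
Qed.

Lemma xstep_pos a : (xstep a).1.2 <= a.1.2.+1 /\ a.1.2 <= (xstep a).1.2.+1.
Proof.
case: a => [[q p] tp]; rewrite /xstep; case: ifP => /= _; first by lia.
by case: (xdelta _ _) => [[q' g] []] /=; lia.
Qed.

Lemma xstep_tape a j : j != a.1.2 -> (xstep a).2 j = a.2 j.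
Proof.
case: a => [[q p] tp] /= jp; rewrite /xstep; case: ifP => //= _.
by case: (xdelta _ _) => [[q' g] mv] /=; rewrite upd_ne.
Qed.

(* Cells of the first row in the nondeterministic region carry a flag telling whether
   the witness has already ended there; all other cells are flagged [None]. *)
Definition acell : finType := (tcell * option bool)%type.

Definition blank_cell : acell := ((tm_blank V, None), None).
Definition start_cell : acell := ((tm_blank V, Some None), None).
Definition bit_cell (b : bool) : acell := ((tm_in V b, None), None).
Definition guess_cell (b : bool) : acell := ((tm_in V b, None), Some false).
Definition end_cell : acell := ((tm_blank V, None), Some true).

Definition flag_ok (x y : acell) : bool := ~~ ((x.2 == Some true) && (y.2 == Some false)).
Definition cell_reject (x : acell) : bool := if x.1.2 is Some q then xreject q else false.

(** The fourth cell lies below the middle one. Its flag is [None], which keeps guessing out of all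
    later rows. *)
Definition tableau_rule (q : quad acell) : bool :=
  let: (a, b, c, d) := q in
  [&& d == (next_cell a.1 b.1 c.1, None), ~~ cell_reject b & flag_ok b c].

Definition is_guess : pred acell := fun x => [|| x == guess_cell false, x == guess_cell true | x == end_cell].

Definition guess_cells (P : nat) (y : seq bool) : seq acell :=
  map guess_cell y ++ nseq (P - size y) end_cell.

Lemma guess_cellsP (s : seq acell) : all is_guess s ->
  (forall j, j.+1 < size s -> flag_ok (nth blank_cell s j) (nth blank_cell s j.+1)) ->
  exists2 y, size y <= size s & s = guess_cells (size s) y.
Proof.
elim: s => [|x s IH] /=; first by exists [::].
case/andP=> gx gs fl; have [|y ys sE] := IH gs; first by move=> j js; apply: (fl j.+1).
have bit b : x = guess_cell b -> exists2 y0, size y0 <= (size s).+1 &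
    x :: s = guess_cells (size s).+1 y0.
  by move=> ->; exists (b :: y) => //=; rewrite /guess_cells /= subSS -/(guess_cells _ _) -sE.
case/or3P: gx => /eqP xE; [exact: bit xE|exact: bit xE|].
exists [::] => //; rewrite /guess_cells /= xE; congr cons.
(* After an end cell [flag_ok] forbids a witness bit, so the witness read from the tail must be
   empty. *)
case: y ys sE => [|b y] /= ys sE; first by rewrite {1}sE /guess_cells /= subn0.
by have := fl 0 ltac:(lia); rewrite xE sE.
Qed.

Variables (c d : nat).
Hypothesis V_time : forall v, halts_within V v (poly_val d (size v)).

Let kinds (w : seq bool) : seq (pred acell) :=
  first_row_kinds (pred1 blank_cell) (pred1 start_cell) is_guess (fun b => pred1 (bit_cell b)) c d w.

Section Row.
Variable w : seq bool.
Let T := run_len c d (size w).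
Let P := guess_len c (size w).
(** The constrained first row is one cell longer than the period [W]: the extra cell is the leftmost
    of the second row, and the first window then determines the cell below its own middle. *)
Let W := (size (kinds w)).-1.

Definition head_row (y : seq bool) : seq acell :=
  map bit_cell (dbl w ++ [:: false; true]) ++ guess_cells P y ++ nseq T.+3 blank_cell.

Definition first_row (y : seq bool) : seq acell :=
  nseq T.+2 blank_cell ++ start_cell :: head_row y.

Lemma width : W = 2 * T + 2 * size w + P + 7.
Proof. by rewrite /W size_first_row_kinds; lia. Qed.

Lemma size_dbl (s : seq bool) : size (dbl s) = 2 * size s.
Proof. by elim: s => //= b s; rewrite /dbl /= => ->; lia. Qed.

(** * The trajectory of the verifier on a fixed witness *)

Section Run.
Variable y : seq bool.
Hypothesis yP : size y <= P.

(** Positions agree with the numbering of cells from 1; position 0 is a blank left neighbour for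
    column 1. *)
Definition tape0 (j : nat) : tm_sym V :=
  if j is i.+1 then (nth blank_cell (first_row y) i).1.1 else tm_blank V.

Definition traj (t : nat) : xconfig := iter t xstep (None, T.+3, tape0).

Lemma trajS t : traj t.+1 = xstep (traj t).
Proof. by []. Qed.

Lemma nth_first_row i : (nth blank_cell (first_row y) i).1 = cell_at (traj 0) i.+1.
Proof.
rewrite /cell_at /= eqSS; apply/eqP; rewrite -pair_eqE /= eqxx /= /first_row nth_cat size_nseq.
have hd j : (nth blank_cell (head_row y) j).1.2 = None.
  have : all (fun x : acell => x.1.2 == None) (head_row y).
    rewrite /head_row /guess_cells !all_cat !all_map !all_nseq /= !orbT !andbT.
    by apply/andP; split; apply/allP.
  move/(all_nthP blank_cell) => h; case: (ltnP j (size (head_row y))) => [/h/eqP//|].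
  by move=> jj; rewrite nth_default.
case: ltngtP => [lt|gt|->]; first by rewrite nth_nseq lt.
  by rewrite -(subnSK gt) /= hd.
by rewrite subnn.
Qed.

Lemma tape0_input j : tape0 (T + 4 + j) = nth (tm_blank V) (map (tm_in V) (pair_enc w y)) j.
Proof.
have -> : T + 4 + j = (T.+2 + j.+1).+1 by lia.
rewrite /tape0 /first_row nth_cat size_nseq ltnNge leq_addr /= addKn /=.
have -> : (nth blank_cell (head_row y) j).1.1 =
    nth (tm_blank V) (map (fun x : acell => x.1.1) (head_row y)) j.
  case: (ltnP j (size (head_row y))) => jj; first by rewrite (nth_map blank_cell).
  by rewrite !nth_default // size_map.
rewrite /head_row /guess_cells /pair_enc -/(dbl w) !map_cat -!map_comp !map_nseq /=.
rewrite -!catA; set s1 := map _ (dbl w); set s2 := map _ y.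
have -> : nseq (P - size y) (tm_blank V) ++ [:: tm_blank V, tm_blank V, tm_blank V & nseq T (tm_blank V)]
   = nseq (P - size y + T.+3) (tm_blank V) by rewrite nseqD.
have nthb (s : seq (tm_sym V)) m i : nth (tm_blank V) (s ++ nseq m (tm_blank V)) i = nth (tm_blank V) s i.
  by rewrite nth_cat nth_nseq; case: ltnP => // h; rewrite (nth_default _ h) if_same.
by rewrite -[RHS](nthb _ (P - size y + T.+3)) -!catA.
Qed.

Lemma first_row_blank i : i < T.+3 \/ W <= i.+1 ->
  nth blank_cell (first_row y) i = if i == T.+2 then start_cell else blank_cell.
Proof.
move=> ii; rewrite /first_row nth_cat size_nseq.
case: ltnP => h; first by rewrite nth_nseq h ifN //; lia.
case: (posnP (i - T.+2)) => [i0|i0]; first by rewrite i0 ifT //; lia.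
rewrite ifN; last by lia.
rewrite -(prednK i0) /= /head_row catA nth_cat.
case: ltnP => h2; last by rewrite nth_nseq if_same.
exfalso; move: h2; rewrite size_cat size_map size_cat size_dbl /guess_cells size_cat size_map size_nseq /=.
by move: ii; rewrite width; lia.
Qed.

Lemma tape0_blank j : j < T + 4 \/ W <= j -> tape0 j = tm_blank V.
Proof.
case: j => // j jj; rewrite /tape0 first_row_blank; last by lia.
by case: ifP.
Qed.

Lemma size_pair_enc : size (pair_enc w y) <= input_len c (size w).
Proof. by rewrite /pair_enc !size_cat -/(dbl w) size_dbl /= /input_len -/P; lia. Qed.

Lemma halt_by_T : halts_within V (pair_enc w y) T.
Proof.
have h := V_time (pair_enc w y); rewrite /halts_within /tm_run.
rewrite (halted_iter h) // /T /run_len /poly_val leq_add2r leq_mul2l.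
by case: (d) => [|e]; rewrite ?eqxx // leq_exp2r // size_pair_enc orbT.
Qed.

Lemma traj_start : represents_tm (tm_init V (pair_enc w y)) (traj 1).
Proof.
rewrite /traj /= upd_id /represents_tm /tm_init; split=> //.
have e j : tape0 (T.+4 + j) = nth (tm_blank V) (map (tm_in V) (pair_enc w y)) j.
  by rewrite -tape0_input; congr tape0; lia.
split.
- by rewrite -[T.+4]addn0 e nth0.
- by move=> j jT; rewrite nth_nil tape0_blank //; lia.
- by move=> j; rewrite e nth_behead.
Qed.

Lemma traj_pos t : t <= T.+1 -> T.+3 <= (traj t).1.2 + t /\ (traj t).1.2 <= T.+3 + t.
Proof.
elim: t => [|t IH] tT; first by rewrite /=; lia.
have [h1 h2] := IH ltac:(lia); have := xstep_pos (traj t).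
by rewrite -[xstep _]/(traj t.+1); lia.
Qed.

(** The indices differ by one because the added state spends a step walking onto the input. *)
Lemma traj_run t : t <= T -> represents_tm (tm_run V t (pair_enc w y)) (traj t.+1).
Proof.
elim: t => [|t IH] tT; first exact: traj_start.
apply: represents_tm_step (IH _); last by lia.
by have := @traj_pos t.+1 ltac:(lia); lia.
Qed.

Lemma traj_halted : xhalt (traj T.+1).1.1.
Proof.
have := traj_run (leqnn T); have := halt_by_T; rewrite /halts_within.
by case: (tm_run _ _ _) (traj T.+1) => [[[q l] h] r] [[q' p] tp] /= hq [-> _].
Qed.

Lemma traj_stuck t : T < t -> traj t = traj T.+1.
Proof.
move=> /subnK <-; elim: (t - T.+1) => // m IH; rewrite addSn trajS IH.
by have := traj_halted; case: (traj T.+1) => [[q p] tp] /= ->.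
Qed.

(** The head makes at most [T.+1] moves from column [T.+3] before the configuration freezes; the
    padding of the first row is dimensioned for this. *)
Lemma traj_bounds t : 2 <= (traj t).1.2 /\ (traj t).1.2 < W.
Proof.
rewrite width; case: (leqP t T.+1) => h; first by have := traj_pos h; lia.
by rewrite traj_stuck; [have := traj_pos (leqnn T.+1); lia|lia].
Qed.

Lemma traj_tape t j : j < 2 \/ W <= j -> (traj t).2 j = tape0 j.
Proof.
move=> jj; elim: t => // t IH; rewrite trajS xstep_tape //.
by apply/eqP => e; have := traj_bounds t; rewrite -e; lia.
Qed.

Lemma traj_blank t j : j < 2 \/ W <= j -> cell_at (traj t) j = (tm_blank V, None).
Proof.
move=> jj; have := traj_tape t jj; have := traj_bounds t.
rewrite tape0_blank; last by lia.
by case: (traj t) => [[q p] tp] /= pW ->; rewrite ifN //; lia.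
Qed.

(** Columns 1 to [W] of the successive configurations, laid end to end. *)
Definition canonical (u : nat) : acell :=
  (cell_at (traj (u.-1 %/ W)) (u.-1 %% W).+1,
   if u <= W then (nth blank_cell (first_row y) u.-1).2 else None).

Lemma canonical_first i : i <= W -> canonical i.+1 = nth blank_cell (first_row y) i.
Proof.
have W0 : 0 < W by rewrite width; lia.
rewrite /canonical [i.+1.-1]/= leq_eqVlt => /orP[/eqP->|iW].
  rewrite ltnn divnn W0 modnn traj_blank; last by left.
  by rewrite first_row_blank ?ifN //; [rewrite width; lia|right].
rewrite iW divn_small // modn_small // -nth_first_row.
by case: (nth _ _ _).
Qed.

Lemma canonical_next v : 0 < v ->
  canonical (v + W.+1) =
  (next_cell (canonical v).1 (canonical v.+1).1 (canonical v.+2).1, None).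
Proof.
move=> v0; have W0 : 0 < W by rewrite width; lia.
rewrite /canonical addnS ifN /=; last by lia.
rewrite divnDr // divnn W0 addn1 modnDr; congr pair.
rewrite trajS cell_at_step; congr next_cell.
(* A wrapped left neighbour is column [W] of the previous row instead of column 0; both are blank
   and without head. *)
- have := divn_eq v W; case: (posnP (v %% W)) => [v1|v1] vE.
    have q0 : 0 < v %/ W by rewrite divn_gt0 // dvdn_leq // /dvdn v1.
    have -> : v.-1 = (v %/ W).-1 * W + W.-1.
      by rewrite {1}vE v1 addn0 -{1}(prednK q0) mulSn -subn1 addnC -addnBA // subn1.
    have W1 : W.-1 < W by rewrite ltn_predL.
    by rewrite /= modnMDl (modn_small W1) prednK // v1 !traj_blank //; [right|left].
  have lt := ltn_pmod v W0.
  have -> : v.-1 = v %/ W * W + (v %% W).-1 by rewrite {1}vE -subn1 -addnBA // subn1.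
  have lt1 : (v %% W).-1 < W by apply: leq_ltn_trans (leq_pred _) lt.
  by rewrite /= divnMDl // modnMDl (divn_small lt1) (modn_small lt1) addn0 prednK.
(* A wrapped right neighbour is column 1 of the next row instead of column [W.+1]; again both are
   blank. *)
- have := divn_eq v W; have lt := ltn_pmod v W0.
  case: (ltnP (v %% W).+1 W) => v1 vE.
    have -> : v.+1 = v %/ W * W + (v %% W).+1 by rewrite {1}vE addnS.
    by rewrite /= divnMDl // modnMDl (divn_small v1) (modn_small v1) addn0.
  have rW : (v %% W).+1 = W by apply/eqP; rewrite eqn_leq lt.
  have -> : v.+1 = (v %/ W).+1 * W by rewrite {1}vE -addnS rW mulSn addnC.
  by rewrite /= mulnK // modnMl rW !traj_blank //; [left|right].
Qed.

Lemma canonical_flag v : flag_ok (canonical v.+1) (canonical v.+2).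
Proof.
rewrite -[flag_ok _ _]/(~~ (((if v < W then (nth blank_cell (first_row y) v).2 else None)
  == Some true) && ((if v.+1 < W then (nth blank_cell (first_row y) v.+1).2 else None)
  == Some false))).
case: (ltnP v.+1 W) => v2; last by rewrite andbF.
rewrite (ltnW v2); set r1 := nseq T.+2 blank_cell ++ start_cell :: map bit_cell (dbl w ++ [:: false; true]).
have -> : first_row y = (r1 ++ map guess_cell y) ++
    (nseq (P - size y) end_cell ++ nseq T.+3 blank_cell).
  by rewrite /r1 /first_row /head_row /guess_cells -!catA.
(* The row is cut where the witness ends: [s1] holds no end flag and [s2] no bit flag. *)
set s1 := r1 ++ _; set s2 := _ ++ nseq T.+3 _.
have a1 : all (fun x : acell => x.2 != Some true) s1.
  rewrite /s1 /r1 !all_cat all_nseq /= !all_map.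
  by do ?(apply/andP; split) => //; apply/allP.
have a2 : all (fun x : acell => x.2 != Some false) s2.
  by rewrite /s2 all_cat !all_nseq /= !orbT.
rewrite (nth_cat _ _ _ v) (nth_cat _ _ _ v.+1); case: (ltnP v (size s1)) => vs.
  by rewrite (negbTE (all_nthP blank_cell a1 v vs)).
rewrite ltnNge (leqW vs) [if ~~ true then _ else _]/=.
case: (ltnP (v.+1 - size s1) (size s2)) => vs2.
  by rewrite (negbTE (all_nthP blank_cell a2 _ vs2)) andbF.
by rewrite (nth_default _ vs2) andbF.
Qed.

Lemma traj_accept : accepts V (pair_enc w y) -> forall t, ~~ xreject (traj t).1.1.
Proof.
case=> t0 [h0 acc]; have ok t : t <= T -> ~~ xreject (traj t.+1).1.1.
  move=> tT; have := traj_run tT; case E: (tm_run V t _) => [[[q l] h] r].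
  case: (traj t.+1) => [[q' p] tp] [-> _] /=; apply/negP => /andP[hq].
  have ht : tm_halt (cfg_state (tm_run V t (pair_enc w y))) by rewrite E.
  have e : tm_run V t (pair_enc w y) = tm_run V t0 (pair_enc w y).
    by rewrite /tm_run -(halted_iter ht (leq_maxl t t0)) -(halted_iter h0 (leq_maxr t t0)).
  by rewrite -e E in acc; rewrite /= in acc; rewrite acc.
case=> [//|t]; case: (leqP t T) => tT; first exact: ok.
by rewrite traj_stuck ?ok // ltnW.
Qed.

Lemma accept_traj : ~~ xreject (traj T.+1).1.1 -> accepts V (pair_enc w y).
Proof.
move=> nr; exists T; split; first exact: halt_by_T.
have := traj_run (leqnn T); have := halt_by_T; rewrite /halts_within; move: nr.
case: (tm_run _ _ _) (traj T.+1) => [[[q l] h] r] [[q' p] tp] /= nr hq [e _].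
by move: nr; rewrite e /= hq /= negbK.
Qed.

End Run.

(** * First rows and witnesses *)

Definition fits (ks : seq (pred acell)) (xs : seq acell) : bool :=
  all2 (fun (K : pred acell) x => K x) ks xs.

Lemma fits_nth ks xs : fits ks xs <->
  size ks = size xs /\ forall i, i < size ks -> nth xpredT ks i (nth blank_cell xs i).
Proof.
elim: ks xs => [|K ks IH] [|x xs] /=; [by split|by split=> // -[]|by split=> // -[]|].
split=> [/andP[Kx /IH[-> h]]|[[sz] h]]; first by split=> // -[|i] //= /h.
have Kx : K x := h 0 isT; rewrite Kx; apply/IH; split=> // i; exact: (h i.+1).
Qed.

Lemma fits_cat ks1 ks2 xs : fits (ks1 ++ ks2) xs ->
  exists xs1 xs2, [/\ xs = xs1 ++ xs2, fits ks1 xs1 & fits ks2 xs2].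
Proof.
elim: ks1 xs => [|K ks IH] [|x xs] //=; try by exists [::], [::].
  by move=> h; exists [::], (x :: xs).
by case/andP=> Kx /IH[xs1 [xs2 [-> h1 h2]]]; exists (x :: xs1), xs2; rewrite /= Kx.
Qed.

Lemma cat_fits ks1 ks2 xs1 xs2 : fits ks1 xs1 -> fits ks2 xs2 -> fits (ks1 ++ ks2) (xs1 ++ xs2).
Proof. by elim: ks1 xs1 => [|K ks IH] [|x xs] //= /andP[-> /IH h] /h. Qed.

Lemma fits_map (T1 : Type) (f : T1 -> acell) s xs :
  fits (map (fun b => pred1 (f b) : pred acell) s) xs <-> xs = map f s.
Proof.
elim: s xs => [|b s IH] [|x xs] /=; split=> //.
  by case/andP=> /eqP-> /IH->.
by case=> -> /IH ->; rewrite eqxx.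
Qed.

Lemma fits_nseq n a xs : fits (nseq n (pred1 a : pred acell)) xs <-> xs = nseq n a.
Proof.
have := fits_map (fun=> a) (nseq n tt) xs.
by rewrite !map_nseq.
Qed.

Lemma fits_guess n xs : fits (nseq n is_guess) xs <-> size xs = n /\ all is_guess xs.
Proof.
elim: n xs => [|n IH] [|x xs] /=; [by split|by split=> // -[]|by split=> // -[]|].
split=> [/andP[-> /IH[-> ->]] //|[[sz] /andP[-> h]]]; exact/IH.
Qed.

Lemma kindsE : kinds w = nseq T.+2 (pred1 blank_cell : pred acell) ++ [:: pred1 start_cell : pred acell] ++
  map (fun b => pred1 (bit_cell b) : pred acell) (dbl w ++ [:: false; true]) ++
  nseq P is_guess ++ nseq T.+3 (pred1 blank_cell : pred acell).
Proof.
rewrite /kinds /first_row_kinds -/T -/P -[T.+3]addn3 -[T.+2]addn2 !nseqD -!catA map_cat.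
congr (_ ++ (_ ++ _)); rewrite -!catA; congr (_ ++ _).
by rewrite /dbl map_flatten -map_comp.
Qed.

Lemma fits_first_row y : size y <= P -> fits (kinds w) (first_row y).
Proof.
move=> yP; rewrite kindsE; apply: cat_fits; first exact/fits_nseq.
apply: (@cat_fits [:: _] _ [:: start_cell]); first by rewrite /= eqxx.
apply: cat_fits; first exact/fits_map.
apply: cat_fits; last exact/fits_nseq.
apply/fits_guess; rewrite /guess_cells size_cat size_map size_nseq subnKC //; split=> //.
rewrite all_cat all_map all_nseq /is_guess eqxx !orbT andbT.
by apply/allP => -[] _ /=; rewrite eqxx ?orbT.
Qed.

(** A window compares the flags of its middle and right cells, so nothing is known about the pair at
    index 0; the guessed region starts further right. *)
Lemma first_row_fits xs : fits (kinds w) xs ->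
  (forall i, i.+2 < size xs -> flag_ok (nth blank_cell xs i.+1) (nth blank_cell xs i.+2)) ->
  exists2 y, size y <= P & xs = first_row y.
Proof.
rewrite kindsE => /fits_cat[x1 [r1 [-> /fits_nseq-> ]]] /fits_cat[x2 [r2 [-> h2]]].
have -> : x2 = [:: start_cell].
  by case: x2 h2 => [|x [|x2 s2]] //= /andP[/eqP-> ].
case/fits_cat=> [x3 [r3 [-> /fits_map-> ]]] /fits_cat[gs [r4 [-> /fits_guess[sg ag]]]].
move/fits_nseq => -> fl.
have [|y ys gE] := guess_cellsP ag.
  move=> j jg; set pre := nseq T.+2 blank_cell ++ [:: start_cell] ++ map bit_cell (dbl w ++ [:: false; true]).
  set post := nseq T.+3 blank_cell in fl.
  have e k : k < size gs -> nth blank_cell (nseq T.+2 blank_cell ++ [:: start_cell] ++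
      map bit_cell (dbl w ++ [:: false; true]) ++ gs ++ post) (size pre + k) = nth blank_cell gs k.
    move=> kg; rewrite (_ : _ ++ _ = pre ++ gs ++ post); last by rewrite /pre -!catA.
    by rewrite nth_cat ltnNge leq_addr addKn nth_cat kg.
  have pre0 : 0 < size pre by rewrite /pre size_cat size_nseq.
  have i1 : (size pre + j).-1.+1 = size pre + j by rewrite prednK // addn_gt0 pre0.
  have := fl (size pre + j).-1; rewrite i1 -(addnS _ j) (e j (ltnW jg)) (e _ jg); apply.
  clear -jg; rewrite /pre !size_cat.
  move: (size (nseq T.+2 _)) (size (map _ _)) => a b; lia.
by exists y; rewrite -?sg // /first_row /head_row -sg -gE.
Qed.

Lemma accept_tiling y : size y <= P -> accepts V (pair_enc w y) ->
  tiling tableau_rule (kinds w) (W.+2 * W.+2) (canonical y).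
Proof.
move=> yP acc; have sk : size (kinds w) = W.+1 by rewrite /W prednK // size_first_row_kinds; lia.
split=> [i ik|v _].
  have [_ /(_ i ik)] := (fits_nth _ _).1 (fits_first_row yP).
  by rewrite canonical_first // -ltnS -sk.
rewrite sk /tableau_rule canonical_next // eqxx canonical_flag // andbT /=.
rewrite /cell_reject /canonical /=; have := traj_accept yP acc (v.+1 %/ W).
by case: (traj y _) => [[q p] tp] /= nr; case: eqP.
Qed.

(** The first row yields a witness, and every later cell is determined by three earlier ones, so by
    strong induction [X] is the canonical tableau of that witness. Rejection is then excluded at the
    cell holding the halted head. *)
Lemma tiling_accept X : tiling tableau_rule (kinds w) (W.+2 * W.+2) X ->
  exists2 y, size y <= P & accepts V (pair_enc w y).
Proof.
have sk : size (kinds w) = W.+1 by rewrite /W prednK // size_first_row_kinds; lia.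
have WE := width.
case=> tk tr; pose xs := mkseq (fun i => X i.+1) W.+1.
have xsE i : i < W.+1 -> nth blank_cell xs i = X i.+1 by move=> iW; rewrite nth_mkseq.
have fx : fits (kinds w) xs.
  by apply/fits_nth; rewrite size_mkseq; split=> // i ik; rewrite xsE -?sk //; apply: tk.
have [|y yP xE] := first_row_fits fx.
  move=> i; rewrite size_mkseq => iW; rewrite !xsE //; last by apply: ltnW.
  by have /and3P[_ _] := tr i ltac:(nia).
exists y => //.
have XE u : u <= W.+1 + W.+2 * W.+2 -> 0 < u -> X u = canonical y u.
  elim/ltn_ind: u => u IH uN u0; case: (leqP u W.+1) => uW.
    by rewrite -(prednK u0) canonical_first // ?xE -?xsE ?xE //; lia.
  have /and3P[/eqP + _ _] := tr (u - W.+2) ltac:(lia).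
  rewrite sk (_ : (u - W.+2).+1 + W.+1 = u); last by lia.
  by move=> ->; rewrite !IH; try lia; rewrite -canonical_next //; congr canonical; lia.
have [p2 pW] := traj_bounds yP T.+1.
(* The cell of the head in row [T.+1], where the verifier has halted; it is the middle cell of
   window [u - 2], which exists because [T.+1] is below [W]. *)
pose u := T.+1 * W + (traj y T.+1).1.2.
have TW : T.+1 * W <= W * W by rewrite leq_mul2r; lia.
have /and3P[_ + _] := tr (u - 2) ltac:(rewrite /u; lia).
rewrite (_ : (u - 2).+2 = u); last by rewrite /u; lia.
rewrite XE; [|rewrite /u; lia|rewrite /u; lia].
rewrite /cell_reject /canonical /=.
have p1 : (traj y T.+1).1.2.-1 < W by apply: leq_ltn_trans (leq_pred _) pW.
rewrite (_ : u.-1 = T.+1 * W + (traj y T.+1).1.2.-1); last by rewrite /u; lia.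
rewrite divnMDl ?modnMDl ?(divn_small p1) ?(modn_small p1) ?addn0 ?prednK //; try lia.
move=> nr; apply: accept_traj => //; move: nr.
by case: (traj y T.+1) => [[q p] tp] /=; rewrite eqxx.
Qed.

End Row.
End Tableau.

Theorem theorem1 : NP_hard EQCONT_SAT.
Proof.
move=> L [V [c [[d V_time] hL]]].
pose KB := pred1 (blank_cell V); pose KS := pred1 (start_cell V).
pose Kb b := pred1 (bit_cell V b).
pose I w := tiling_instance_of (@tableau_rule V) KB KS (@is_guess V) Kb c d w.
exists (fun w => enc_instance (I w)); split; first exact: tiling_poly_time_computable.
move=> w; pose ks : seq (pred (acell V)) := first_row_kinds KB KS (@is_guess V) Kb c d w.
have ks2 : 1 < size ks by rewrite size_first_row_kinds !addnS.
have kW : (size ks).+1 = (size ks).-1.+2 by rewrite prednK // ltnW.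
rewrite hL; split=> [[y [yP acc]]|[I' [_ /enc_instance_inj -> /sat_tiling sat]]].
  exists (I w); split=> //; first exact: tiling_instance_wf.
  apply: tiling_sat => //; rewrite kW; exact: (accept_tiling V_time yP acc).
have [X] := sat (blank_cell V) ks2; rewrite kW => /(tiling_accept V_time)[y yP acc].
by exists y.
Qed.
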